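(* Let $r>0$ and suppose $\lambda\in\overline\Lambda^r(p)$. Then the dimension of the simple $kS_r$-module $D_r(\lambda)$ is recursively determined by $$\dim D_r(\lambda)=\sum_{i:\ \lambda-\epsilon_i\in\overline\Lambda^{(r-1)}(p)}\dim D_{r-1}(\lambda-\epsilon_i).$$
   Context: $k$ is a field of characteristic $p>2$ and $S_r$ is the symmetric group on $r$ letters. For $m\ge 1$, $\epsilon_1,\dots,\epsilon_m$ denotes the standard basis of $\mathbb Z^m$, and a partition with at most $m$ non-zero parts is written $\lambda=(\lambda_1,\dots,\lambda_m)=\sum_i\lambda_i\epsilon_i$ with $\lambda_1\ge\cdots\ge\lambda_m\ge 0$ and regarded as an element of $\mathbb Z^m$. For $m\ge 2$, $A_m(p)=\{\lambda\in\mathbb Z^m\mid \lambda_1\ge\cdots\ge\lambda_m,\ \lambda_1-\lambda_m\le p-m\}$ (the bottom dominant alcove for $GL_m$), and $A_1(p)=\mathbb Z\epsilon_1$. $\Lambda^r$ is the set of partitions of $r$, and $$\overline\Lambda^r(p)=\{(\lambda_1,\lambda_2,\dots,\lambda_m)\in\Lambda^r\mid \lambda\in A_m(p)\text{ for some } m<p\};$$ $\overline\Lambda^{(r-1)}(p)$ is the corresponding set of partitions of $r-1$. All partitions in $\overline\Lambda^r(p)$ are $p$-regular, i.e. no $p$ rows have the same length. The simple $kS_r$-modules are indexed by the $p$-regular partitions of $r$, and $D_r(\lambda)$ denotes the one corresponding to $\lambda$: it is the unique simple quotient of the Specht (cell) module of $\lambda$, realized as $\operatorname{Hom}_{GL_r}(\Delta_r(\lambda),V_r^{\otimes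 r})$, where $V_r=k^r$ is the natural module for $GL_r=GL_r(k)$, $\Delta_r(\lambda)$ is the Weyl module for $GL_r$ with highest weight $\lambda$, and $kS_r\simeq\operatorname{End}_{GL_r}(V_r^{\otimes r})$. In particular $D_r((r))$ is the trivial module $k$. For $r=0$ the convention is $kS_0=k$ and $D_0(\emptyset)=k$. *)

(* Defs.v *)
From HB Require Import structures.
From mathcomp Require Import all_boot all_order all_algebra.
From mathcomp Require Import all_fingroup all_character.
From Stdlib Require Import ClassicalEpsilon.
Set Implicit Arguments.
Unset Strict Implicit.
Unset Printing Implicit Defensive.
Import Order.TTheory GRing.Theory Num.Theory.
Local Open Scope ring_scope.

(* Weights of GL_m are row vectors over int, with m = n.+1, and epsilon_i is  *)
(* delta_mx 0 i.                                                              *)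

Definition dominant n (la : 'rV[int]_n) : bool :=
  [forall i : 'I_n, forall j : 'I_n, (i <= j)%N ==> (la 0 j <= la 0 i)].

Definition bottom_alcove (p n : nat) (la : 'rV[int]_n.+1) : bool :=
  dominant la &&
  ((n == 0)%N || (la 0 ord0 - la 0 ord_max <= p%:Z - n.+1%:Z)).

Definition partition_of (r n : nat) (la : 'rV[int]_n) : bool :=
  [&& dominant la, [forall i : 'I_n, 0 <= la 0 i] & \sum_i la 0 i == r%:Z].

(* The m-tuple la (m = n.+1) belongs to the set \overline\Lambda^r(p).  The   *)
(* length m of the tuple is the m of A_m(p): zero entries are allowed, but    *)
(* (a, 0) is tested against A_2(p), not against A_1(p).                       *)
Definition Lambda_bar (p r n : nat) (la : 'rV[int]_n.+1) : bool :=
  [&& partition_of r la, bottom_alcove p la & (n.+1 < p)%N].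

Definition parts n (la : 'rV[int]_n) : seq nat := [seq absz (la 0 i) | i : 'I_n].

(* Column lengths of a partition; trailing zero parts have no effect.         *)
Definition conj_part (la : seq nat) : seq nat :=
  [seq count (fun x => j < x)%N la | j <- iota 0 (head 0%N la)].

(* V_r^{\otimes r} in the basis e_w = e_{w_0} \otimes ... \otimes e_{w_{r-1}} *)
(* indexed by words w; tensorsp A r is A \otimes_k V_r^{\otimes r}.           *)
Definition word (r : nat) := r.-tuple 'I_r.
Notation tensorsp A r := {ffun word r -> A^o}.

(* g \otimes ... \otimes g, where g e_b = \sum_a g_{ab} e_a.                  *)
Definition gl_act (A : comUnitRingType) r (g : 'M[A]_r) (x : tensorsp A r) :
    tensorsp A r :=
  [ffun w : word r =>
     \sum_(u : word r) (\prod_(j < r) g (tnth w j) (tnth u j)) * x u].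

(* Place permutations: the letter in place i moves to place s i.  Since       *)
(* (s * t) i = t (s i), these operators form a right action of 'S_r, in       *)
(* accordance with the row-vector convention of mx_representation.            *)
Definition place_word r (s : 'S_r) (w : word r) : word r :=
  [tuple tnth w (s i) | i < r].

Definition place_act (k : fieldType) r (s : 'S_r) (x : tensorsp k r) :
    tensorsp k r :=
  [ffun w => x (place_word s w)].

Fact place_act_is_linear (k : fieldType) r (s : 'S_r) :
  linear (@place_act k r s).
Proof. by move=> a x y; apply/ffunP=> w; rewrite !ffunE. Qed.

HB.instance Definition _ (k : fieldType) r (s : 'S_r) :=
  GRing.isLinear.Build k (tensorsp k r) (tensorsp k r) _ (@place_act k r s)
    (@place_act_is_linear k r s).

(* The element \sum_i a_i \otimes b_i of A \otimes_k V_r^{\otimes r}, the     *)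
(* k-algebra A being given by its structure morphism iota.                    *)
Definition tens_comb (k : fieldType) (A : comUnitRingType)
    (iota : {rmorphism k -> A}) r m (a : 'I_m -> A) (b : 'I_m -> tensorsp k r) :
    tensorsp A r :=
  [ffun w => \sum_(i < m) a i * iota (b i w)].

Definition base_change (k : fieldType) (A : comUnitRingType)
    (iota : {rmorphism k -> A}) r (x : tensorsp k r) : tensorsp A r :=
  [ffun w => iota (x w)].

(* GL_r is the group scheme over k (k may be finite), so stability and        *)
(* equivariance are tested on the A-points for all commutative k-algebras A.  *)
Definition gl_stable (k : fieldType) r (W : {vspace tensorsp k r}) : Prop :=
  forall (A : comUnitRingType) (iota : {rmorphism k -> A}) (g : 'M[A]_r),
    g \in unitmx ->
  forall v : tensorsp k r, v \in W ->
  exists (m : nat) (a : 'I_m -> A) (b : 'I_m -> tensorsp k r),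
    (forall i, b i \in W) /\
    gl_act g (base_change iota v) = tens_comb iota a b.

(* f : W -> V_r^{\otimes r} is GL_r-equivariant:                              *)
(* g (1 \otimes v) = \sum_i a_i \otimes b_i in A \otimes W implies            *)
(* g (1 \otimes f v) = \sum_i a_i \otimes f b_i.                              *)
Definition gl_hom (k : fieldType) r (W : {vspace tensorsp k r})
    (f : 'Hom(subvs_of W, tensorsp k r)) : Prop :=
  forall (A : comUnitRingType) (iota : {rmorphism k -> A}) (g : 'M[A]_r),
    g \in unitmx ->
  forall (v : subvs_of W) (m : nat) (a : 'I_m -> A) (b : 'I_m -> subvs_of W),
    gl_act g (base_change iota (vsval v)) =
      tens_comb iota a (fun i => vsval (b i)) ->
    gl_act g (base_change iota (f v)) = tens_comb iota a (fun i => f (b i)).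

(* Coordinate at the word s, of length h, of the antisymmetrised tensor       *)
(* \sum_{t in S_h} sgn(t) e_{t 0} \otimes ... \otimes e_{t (h-1)},            *)
(* i.e. the image of e_0 /\ ... /\ e_{h-1} in V^{\otimes h}.                  *)
Definition alt_coef (k : fieldType) (s : seq nat) : k :=
  \det (\matrix_(i < size s, j < size s) (nth 0%N s i == j)%:R).

(* Canonical highest weight vector of weight la: the tensor product over the  *)
(* columns, of lengths h_1 >= h_2 >= ..., of the antisymmetrised              *)
(* e_0 /\ ... /\ e_{h_j - 1}.                                                 *)
Definition hw_tensor (k : fieldType) r (la : seq nat) : tensorsp k r :=
  [ffun w : word r =>
     \prod_(s <- reshape (conj_part la) [seq val i | i <- w]) alt_coef k s].

(* The Weyl module \Delta_r(la), in the Carter-Lusztig model: the             *)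
(* GL_r-submodule of V_r^{\otimes r} generated by hw_tensor.                  *)
Definition is_weyl (k : fieldType) r (la : seq nat)
    (W : {vspace tensorsp k r}) : Prop :=
  [/\ hw_tensor k r la \in W, gl_stable W &
      forall U : {vspace tensorsp k r},
        hw_tensor k r la \in U -> gl_stable U -> (W <= U)%VS].

(* rD is a simple quotient of the Specht module Hom_{GL_r}(W, V_r^{\otimes r})*)
(* on which S_r acts through place permutations of the target.  Only the      *)
(* values of pi on gl_hom matter: a linear map given on that subspace always  *)
(* extends to the whole of 'Hom(W, V_r^{\otimes r}).                          *)
Definition simple_quotient_specht (k : fieldType) r (la : seq nat) d
    (rD : mx_representation k [set: 'S_r] d) : Prop :=
  mx_irreducible rD /\
  exists W : {vspace tensorsp k r}, is_weyl la W /\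
  exists pi : 'Hom('Hom(subvs_of W, tensorsp k r), 'rV[k]_d),
    (forall (s : 'S_r) (f : 'Hom(subvs_of W, tensorsp k r)), gl_hom f ->
       pi (linfun (place_act s) \o f)%VF = pi f *m rD s) /\
    (forall v : 'rV[k]_d,
       exists2 f : 'Hom(subvs_of W, tensorsp k r), gl_hom f & pi f = v).

(* D_r(la), together with its dimension.                                      *)
Definition simple_mod (k : fieldType) r (la : seq nat) :
    {d : nat & mx_representation k [set: 'S_r] d} :=
  epsilon (inhabits (existT _ _ (regular_repr k [set: 'S_r])))
    (fun D => simple_quotient_specht la (projT2 D)).

Definition dimD (k : fieldType) r n (la : 'rV[int]_n) : nat :=
  projT1 (simple_mod k r (parts la)).

(* Main.v *)
From HB Require Import structures.
Require Import Defs.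
From mathcomp Require Import all_boot all_order all_algebra.
From mathcomp Require Import all_fingroup all_solvable all_character.
From mathcomp Require Import mpoly zify ring.
From Stdlib Require Import Classical_Prop ClassicalEpsilon.
Set Implicit Arguments.
Unset Strict Implicit.
Unset Printing Implicit Defensive.
Import Order.TTheory GRing.Theory Num.Theory.
Local Open Scope ring_scope.

(** The dimension of $D_r(\lambda)$ is the number of walks from $0$ to $\lambda$
    that stay in the bottom alcove and whose steps are the $\epsilon_i$; the
    recursion then sorts these walks by their last step. To prove this, a
    simple module with a basis indexed by the walks is written down and is
    identified with $D_r(\lambda)$.

    The module is a seminormal form of Young. Inside the alcove the shifted
    coordinates $\lambda_i-i$ are pairwise distinct modulo $p$, so the
    denominators in Young's formulas do not vanish, and a transposition that
    would make a walk leave the alcove acts by $-1$, exactly as one that would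
    destroy dominance ([leaving_alcove]). Checking the Coxeter relations gives
    a representation of $S_r$ ([coxeter_repr], [seminormal_repr_exists]). It is
    irreducible because the Jucys--Murphy elements act diagonally and separate
    the walks, and because any two walks with the same end are linked by
    elementary exchanges ([seminormal_irreducible], [walks_connected]).

    To recognise a simple module it suffices to find in it a nonzero Garnir
    vector ([garnir]): a vector that alternates under the column stabiliser $C$
    of $\lambda$ and satisfies the exchange relations between a column and a box
    of a later column. Write $\kappa=\sum_{s\in C}\mathrm{sgn}(s)s$. Since the
    columns are shorter than $p$, these relations imply that
    $v\sigma\kappa=c(\sigma)v$ with a scalar $c(\sigma)$ that does not depend
    on the module ([proportional_all]). Consequently the annihilator of a nonzero
    Garnir vector is contained in that of any Garnir vector of a simple module
    ([garnir_ann]), and two simple modules that contain nonzero Garnir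
    vectors have the same dimension ([garnir_irr_dim]).

    Such vectors exist on both sides. In the seminormal module one takes the walk
    that fills the columns of $\lambda$ one after the other
    ([column_word_garnir]); in the tensor space one takes the highest weight
    tensor ([hw_tensor_garnir]). The action of a generic matrix shows that
    an equivariant map from the Weyl module to $V_r^{\otimes r}$ is a combination
    of place permutations ([hom_place_act]). Hence the Specht module is generated
    by the inclusion of the Weyl module, every simple quotient inherits a
    nonzero Garnir vector ([quotient_garnir]), and conversely the seminormal
    module is such a quotient ([quotient_of_garnir]). *)

(** * Garnir vectors in modules over the symmetric group *)

Definition right_action (k : fieldType) r (E : lmodType k)
    (act : 'S_r -> E -> E) : Prop :=
  [/\ forall s, linear (act s), forall x, act 1%g x = x &
      forall s t x, act (s * t)%g x = act t (act s x)].

Definition col_class r (col : 'I_r -> nat) (c : nat) : {set 'I_r} :=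
  [set q | col q == c].

Definition col_stab r (col : 'I_r -> nat) : {set 'S_r} :=
  [set s : 'S_r | [forall q, col (s q) == col q]].

(** The second clause says that $v$ is killed by the signed sum over the cosets of
    $S_{I_c}$ in $S_{I_c\cup\{x\}}$, where $I_c$ is the set of places of column
    $c$. For a tensor this is the vanishing of an antisymmetrisation over more
    places than there are admissible letters, so these vectors play the part of
    highest weight vectors. *)
Definition garnir (k : fieldType) r (col : 'I_r -> nat) (E : lmodType k)
    (act : 'S_r -> E -> E) (v : E) : Prop :=
  (forall a b, a != b -> col a = col b -> act (tperm a b) v = - v) /\
  (forall x c, (c < col x)%N ->
     v = \sum_(a in col_class col c) act (tperm a x) v).

Definition antisym (k : fieldType) r (col : 'I_r -> nat) (E : lmodType k)
    (act : 'S_r -> E -> E) (v : E) : E :=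
  \sum_(s in col_stab col) (-1) ^+ (odd_perm s) *: act s v.

Section GarnirModule.

Variables (k : fieldType) (r : nat) (col : 'I_r -> nat).

Lemma col_stabP (s : 'S_r) :
  reflect (forall q, col (s q) = col q) (s \in col_stab col).
Proof. by rewrite inE; apply: (iffP forallP) => h q; apply/eqP. Qed.

Fact col_stab_group_set : group_set (col_stab col).
Proof.
apply/group_setP; split=> [|s t /col_stabP hs /col_stabP ht].
  by apply/col_stabP => q; rewrite perm1.
by apply/col_stabP => q; rewrite permM ht hs.
Qed.

Canonical col_stab_group := Group col_stab_group_set.

Variables (E : lmodType k) (act : 'S_r -> E -> E).
Hypothesis hact : right_action act.

Lemma act_linear s : linear (act s). Proof. by case: hact. Qed.
Lemma right_act1 x : act 1%g x = x. Proof. by case: hact. Qed.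
Lemma right_actM s t x : act (s * t)%g x = act t (act s x). Proof. by case: hact. Qed.

HB.instance Definition _ s := GRing.isLinear.Build k E E _ (act s) (act_linear s).

Lemma antisym_is_linear : linear (antisym col act).
Proof.
move=> a x y; rewrite /antisym scaler_sumr -big_split /=.
by apply: eq_bigr => s _; rewrite linearP scalerDr !scalerA mulrC.
Qed.

HB.instance Definition _ := GRing.isLinear.Build k E E _ (antisym col act)
  antisym_is_linear.

Lemma actZ s a x : act s (a *: x) = a *: act s x. Proof. exact: linearZ. Qed.

Lemma act_0 s : act s 0 = 0. Proof. exact: linear0. Qed.

Lemma antisym_0 : antisym col act 0 = 0. Proof. exact: linear0. Qed.

Lemma act_sum s (I : finType) (P : pred I) (F : I -> E) :
  act s (\sum_(i | P i) F i) = \sum_(i | P i) act s (F i).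
Proof. exact: linear_sum. Qed.

Lemma antisymZ a x : antisym col act (a *: x) = a *: antisym col act x.
Proof. exact: linearZ. Qed.

Lemma antisym_sum (I : finType) (P : pred I) (F : I -> E) :
  antisym col act (\sum_(i | P i) F i) = \sum_(i | P i) antisym col act (F i).
Proof. exact: linear_sum. Qed.

Lemma antisym_tperm a b v : a != b -> col a = col b ->
  antisym col act (act (tperm a b) v) = - antisym col act v.
Proof.
move=> nab cab; have tC : tperm a b \in col_stab col.
  by apply/col_stabP => q; case: tpermP => [->|->|].
rewrite /antisym (reindex_inj (mulgI (tperm a b))) /= -sumrN.
apply: eq_big => [s|s _]; first by rewrite groupMl.
rewrite odd_mul_tperm nab -right_actM mulgA tperm2 mul1g.
by case: (odd_perm s); rewrite ?scaleN1r ?scale1r ?opprK.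
Qed.

Lemma col_alternating v :
    (forall a b, a != b -> col a = col b -> act (tperm a b) v = - v) ->
  forall s, s \in col_stab col -> act s v = (-1) ^+ (odd_perm s) *: v.
Proof.
move=> hv s; have [n] := ubnP #|[pred x | s x != x]|; elim: n s => // n IHn s.
rewrite ltnS => le_s sC.
case: (pickP (fun x => s x != x)) => [x sx | s_id]; last first.
  have -> : s = 1%g by apply/permP => x; rewrite perm1; have /eqP := s_id x.
  by rewrite right_act1 odd_perm1 scale1r.
set t := tperm x (s x); have cx : col x = col (s x).
  by move/col_stabP: sC => ->.
have tC : t \in col_stab col.
  by apply/col_stabP => q; rewrite /t; case: tpermP => [->|->|].
have {1}-> : s = (s * t * t)%g by rewrite -mulgA tperm2 mulg1.
have nxs : x != s x by rewrite eq_sym.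
rewrite right_actM IHn ?groupM //; last first.
  apply: leq_trans le_s; apply: proper_card; apply/properP; split.
    apply/subsetP => y; rewrite !inE permM /t.
    case: tpermP => [e|/perm_inj -> |//]; rewrite ?eqxx //.
    by apply: contraNneq => e'; rewrite -e !e'.
  by exists x; rewrite !inE ?permM /t ?tpermR ?eqxx.
rewrite linearZ /= hv // scalerN -scaleNr odd_permM /t odd_tperm nxs addbT.
by case: (odd_perm _); rewrite ?opprK.
Qed.

Lemma antisym_id v :
    (forall a b, a != b -> col a = col b -> act (tperm a b) v = - v) ->
  antisym col act v = #|col_stab col|%:R *: v.
Proof.
move=> hv; rewrite /antisym (eq_bigr (fun=> v)) => [|s sC].
  by rewrite sumr_const scaler_nat.
by rewrite col_alternating // scalerA -expr2 sqrr_sign scale1r.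
Qed.

(** The exchange with a later column follows by composition from exchanges
    between neighbouring columns, and inside a column any place may be reached
    from any other one by a transposition that only changes the sign. *)
Lemma garnir_of_neighbours v :
    (forall a b, a != b -> col a = col b -> act (tperm a b) v = - v) ->
    (forall x c, col x = c.+1 -> exists2 x0, col x0 = c.+1 &
       v = \sum_(a in col_class col c) act (tperm a x0) v) ->
  garnir col act v.
Proof.
move=> alt nbr; split=> // x c cx.
have next y b : col y = b.+1 -> v = \sum_(a in col_class col b) act (tperm a y) v.
  move=> ey; have [y0 ey0 ev] := nbr y b ey.
  case: (eqVneq y0 y) => [<- //|ny].
  have e0 : act (tperm y0 y) v = - v by apply: alt; rewrite ?ey0 ?ey.
  apply: oppr_inj; rewrite -{1}e0 {1}ev act_sum -sumrN; apply: eq_bigr => a.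
  rewrite inE => /eqP ea.
  have nz z : col z = b.+1 -> a != z by move=> ez; apply/eqP => e; move: ea;
    rewrite e ez; lia.
  rewrite -right_actM conjgC tpermJ tpermL tpermD ?right_actM ?e0 1?eq_sym ?nz //.
  by rewrite -scaleN1r actZ scaleN1r.
have [d ed] : {d | col x = (c + d.+1)%N} by exists (col x - c.+1)%N; lia.
elim: d x ed {cx} => [|d IHd] x ed; first by apply: next; rewrite ed addn1.
have ev := next x (c + d.+1)%N (eq_trans ed (addnS _ _)).
rewrite {1}ev [X in _ = \sum_(a in _) act _ X]ev.
under [RHS]eq_bigr => a _ do rewrite act_sum.
rewrite exchange_big /=; apply: eq_bigr => y; rewrite inE => /eqP ey.
rewrite {1}(IHd y ey) act_sum; apply: eq_bigr => a; rewrite inE => /eqP ea.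
have ay : a != y by apply/eqP => e; move: ea; rewrite e ey; lia.
have ax : a != x by apply/eqP => e; move: ea; rewrite e ed; lia.
rewrite -!right_actM; congr (act _ _).
by rewrite [LHS]conjgC tpermJ tpermL tpermD // 1?eq_sym //.
Qed.

End GarnirModule.

Section GarnirVectors.

Variables (k : fieldType) (p : nat).
Hypothesis hp : p \in [pchar k].
Variables (r : nat) (col : 'I_r -> nat).
Hypothesis col_small : forall c, (#|col_class col c| < p)%N.

Lemma natr_neq0_small m : (0 < m < p)%N -> m%:R != 0 :> k.
Proof.
by case/andP=> m0 mp; rewrite -(dvdn_pcharf hp) gtnNdvd.
Qed.

(** An element of order $p$ of the column stabiliser would have an orbit of
    $p$ places inside a single column. *)
Lemma card_col_stab_neq0 : #|col_stab col|%:R != 0 :> k.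
Proof.
have pp : prime p := pcharf_prime hp.
rewrite -(dvdn_pcharf hp); apply/negP => /(Cauchy pp) [s sC os].
have /eqP s1 : s == 1%g.
  apply/eqP/permP => q; rewrite perm1.
  have sub : porbit s q \subset col_class col (col q).
    apply/subsetP => x /porbitP [i ->]; rewrite inE.
    by have /col_stabP -> := groupX i sC.
  have : (#|porbit s q| %| #[s]%g)%N by rewrite porbitE dvdn_orbit.
  rewrite os => /(primeP pp).2 /orP [|/eqP e]; last first.
    by have := leq_ltn_trans (subset_leq_card sub) (col_small _); rewrite e ltnn.
  move/cards1P => [z ez].
  have : q \in porbit s q by rewrite porbit_id.
  have : s q \in porbit s q by rewrite -{1}(expg1 s) mem_porbit.
  by rewrite ez !inE => /eqP -> /eqP.
by move: os; rewrite s1 order1 => e; rewrite -e in pp.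
Qed.

(** The scalar is chosen before the module and the vector: this uniformity is what
    makes different modules comparable. *)
Definition proportional (s : 'S_r) : Prop :=
  exists c : k, forall (E : lmodType k) (act : 'S_r -> E -> E) (v : E),
    right_action act -> garnir col act v ->
    antisym col act (act s v) = c *: v.

Lemma proportional_stab s : s \in col_stab col -> proportional s.
Proof.
move=> sC; exists ((-1) ^+ odd_perm s * #|col_stab col|%:R) => E act v hact [hv _].
by rewrite (col_alternating hact hv sC) antisymZ // antisym_id // scalerA.
Qed.

(** If $\sigma$ does not preserve column $c$, then some place $b$ of this column is the
    image of a place $x$ of a later column. The exchange relation rewrites
    $v\sigma\kappa$ as the sum of the $v(y\,x)\sigma\kappa$ over the places $y$ of
    column $c$. When $\sigma(y)$ is in column $c$ the term equals
    $-v\sigma\kappa$, as $\kappa$ absorbs the transposition of $\sigma(y)$ and $b$;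
    otherwise $(y\,x)\sigma$ preserves column $c$ better than $\sigma$. The number
    of terms of the first kind is smaller than the height of the column, so one
    may divide by it plus one. *)
Lemma proportional_exchange c (s : 'S_r) y :
    (forall x, (col x < c)%N -> col (s x) = col x) ->
    (forall t : 'S_r, (forall x, (col x < c)%N -> col (t x) = col x) ->
      (#|[set z in col_class col c | col (t z) != c]| <
       #|[set z in col_class col c | col (s z) != c]|)%N -> proportional t) ->
    col y = c -> col (s y) != c -> proportional s.
Proof.
move=> fix_s IH cy csy.
have /exists_inP [b] : [exists b in col_class col c, b \notin s @: col_class col c].
  apply: contraT => /existsPn all_b.
  have sub : col_class col c \subset s @: col_class col c.
    by apply/subsetP => z; rewrite inE => cz; move: (all_b z); rewrite inE cz /= negbK.
  have /eqP e : col_class col c == s @: col_class col c.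
    by rewrite eqEcard sub card_imset ?leqnn //; apply: perm_inj.
  have : s y \in s @: col_class col c by rewrite imset_f // inE cy eqxx.
  by rewrite -e inE (negbTE csy).
rewrite inE => /eqP cb bNs.
pose x := s^-1%g b; have sx : s x = b by rewrite permKV.
have cx : (c < col x)%N.
  rewrite ltn_neqAle leqNgt; apply/andP; split.
    apply: contra bNs => /eqP e; rewrite -sx imset_f // inE -e eqxx //.
  by apply/negP => lt; move: (fix_s _ lt); rewrite sx cb => e; rewrite -e ltnn in lt.
have nx z : col z = c -> z != x by move=> cz; apply: contraTneq cx => <-; rewrite cz ltnn.
pose bad := [set z in col_class col c | col (s z) != c].
have /fin_all_exists [f hf] : forall z : 'I_r, exists e : k, z \in bad ->
    forall (E : lmodType k) (act : 'S_r -> E -> E) (v : E),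
    right_action act -> garnir col act v ->
    antisym col act (act (tperm z x * s)%g v) = e *: v.
  move=> z; have [zb|zb] := boolP (z \in bad); last by exists 0.
  have [/eqP cz csz] : col z == c /\ col (s z) != c by move: zb; rewrite !inE => /andP.
  have [||e he] := IH (tperm z x * s)%g; last by exists e.
    move=> q qc; rewrite permM tpermD ?fix_s //.
      by apply: contraTneq qc => <-; rewrite cz ltnn.
    by apply: contraTneq qc => <-; rewrite -leqNgt ltnW.
  apply: proper_card; apply/properP; split.
    apply/subsetP => q; rewrite !inE permM => /andP [/eqP cq].
    case: tpermP => [->|e|_ _]; rewrite ?cz ?csz ?cq ?eqxx //.
    by rewrite e in cq; rewrite cq ltnn in cx.
  by exists z => //; rewrite !inE permM tpermL sx cb eqxx andbF.
(* The place y is not counted by g, hence 1 + g is at most the height. *)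
pose g := #|[set z in col_class col c | col (s z) == c]|.
have g1 : (1 + g)%:R != 0 :> k.
  apply: natr_neq0_small; rewrite addnC addn1 /=; apply: leq_ltn_trans (col_small c).
  apply: proper_card; apply/properP; split.
    by apply/subsetP => q; rewrite !inE => /andP [].
  by exists y; rewrite !inE ?cy ?eqxx // (negbTE csy).
exists ((1 + g)%:R^-1 * \sum_(z in bad) f z) => E act v hact gv.
apply: (scalerI g1); rewrite scalerA mulrA divff // mul1r.
have [_ /(_ x c cx) ev] := gv.
rewrite {1}natrD scalerDl scale1r {1}ev.
(* The terms with s(z) in column c reproduce the left-hand side with a sign. *)
rewrite act_sum // antisym_sum // (bigID (fun z => col (s z) == c)) /=.
rewrite [X in X + _ + _](eq_bigr (fun=> - antisym col act (act s v))); last first.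
  move=> z; rewrite inE => /andP [/eqP cz /eqP csz].
  rewrite -right_actM // -(antisym_tperm hact (a := s z) (b := b)) //;
    last by rewrite csz cb.
    by rewrite -right_actM // -sx -tpermJ conjgE !mulgA mulgV mul1g.
  by rewrite -sx (inj_eq perm_inj) nx.
rewrite sumr_const mulNrn addrC addrA.
have -> : #|[pred i in col_class col c | col (s i) == c]| = g.
  by apply: eq_card => q; rewrite !inE.
rewrite -scaler_nat subrr add0r scaler_suml.
apply: eq_big => [z|z zb]; first by rewrite !inE.
by rewrite -right_actM // hf // !inE; move: zb; rewrite inE.
Qed.

Lemma proportional_all s : proportional s.
Proof.
suff stage d c (t : 'S_r) : (\max_q (col q).+1 - c = d)%N ->
    (forall x, (col x < c)%N -> col (t x) = col x) -> proportional t.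
  exact: (stage _ 0%N).
elim: d c t => [|d IHd] c t.
  move/eqP; rewrite subn_eq0 => cmax fix_t; apply: proportional_stab.
  apply/col_stabP => q; apply: fix_t; apply: leq_trans cmax.
  exact: (leq_bigmax q).
move=> ed; have [m] := ubnP #|[set z in col_class col c | col (t z) != c]|.
elim: m t => // m IHm t; rewrite ltnS => le_m fix_t.
have [e0|/set0Pn [y]] := eqVneq [set z in col_class col c | col (t z) != c] set0.
  apply: (IHd c.+1); first by rewrite subnS ed.
  move=> x; rewrite ltnS leq_eqVlt => /orP [/eqP cx|]; last exact: fix_t.
  have := in_set0 x; rewrite -e0 !inE cx eqxx /= => /negbFE /eqP ->; exact: esym.
rewrite !inE => /andP [/eqP cy cty].
apply: (proportional_exchange fix_t _ cy cty) => u fix_u lt_u.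
by apply: IHm => //; apply: leq_trans lt_u _.
Qed.

Lemma repr_right_action d (rG : mx_representation k [set: 'S_r] d) :
  right_action (fun s (w : 'rV[k]_d) => w *m rG s).
Proof.
split=> [s a x y|x|s t x]; first by rewrite mulmxDl scalemxAl.
  by rewrite repr_mx1 mulmx1.
by rewrite repr_mxM ?inE // mulmxA.
Qed.

(** Let $a=\sum_s f(s)s$ with $va=0$ but $ua\neq0$. By irreducibility $uab=u$ for
    some $b$; applying $\kappa$, the universal scalar of $ab$ is $|C|\neq0$, and
    so $|C|v=vab\kappa=0$. *)
Lemma garnir_ann d (rG : mx_representation k [set: 'S_r] d) (u : 'rV[k]_d)
    (E : lmodType k) (act : 'S_r -> E -> E) (v : E) (f : 'S_r -> k) :
    mx_irreducible rG -> garnir col (fun s w => w *m rG s) u ->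
    right_action act -> garnir col act v -> v != 0 ->
    \sum_s f s *: act s v = 0 -> \sum_s f s *: (u *m rG s) = 0.
Proof.
move=> irr gu hact gv v0 fv0; apply/eqP; apply: contraTT isT => u'0.
set u' := \sum_s _ in u'0.
have [_ _ simple] := irr.
have hG := repr_right_action rG.
have : (1%:M <= cyclic_mx rG u')%MS.
  by apply: simple; rewrite ?cyclic_mx_module ?submx1 ?cyclic_mx_eq0.
move/(submx_trans (submx1 u))/cyclic_mxP => [A /envelop_mxP [b ->] eu].
have [c hc] := fin_all_exists proportional_all.
have u0 : u != 0.
  by apply: contraNneq u'0 => e; rewrite /u' big1 // => s _; rewrite e mul0mx scaler0.
have expand (E' : lmodType k) act' (v' : E') : right_action act' -> garnir col act' v' ->
    antisym col act' (\sum_t b t *: act' t (\sum_s f s *: act' s v')) =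
    (\sum_t b t * \sum_s f s * c (s * t)%g) *: v'.
  move=> h' g'; rewrite antisym_sum // scaler_suml; apply: eq_bigr => t _.
  rewrite antisymZ // act_sum // antisym_sum // -scalerA; congr (_ *: _).
  rewrite scaler_suml; apply: eq_bigr => s _.
  by rewrite actZ // antisymZ // -right_actM // hc // scalerA.
have := expand _ _ _ hact gv; rewrite fv0 big1 => [|t _]; last first.
  by rewrite act_0 // scaler0.
have := expand _ _ _ hG gu; rewrite -/u'.
have <- : u = \sum_t b t *: (u' *m rG t).
  rewrite {1}eu mulmx_sumr; apply: eq_big => [t|t _]; first by rewrite inE.
  by rewrite scalemxAr.
rewrite antisym_id //; last by case: gu.
move/eqP; rewrite -subr_eq0 -scalerBl scaler_eq0 (negbTE u0) orbF subr_eq0 => /eqP <-.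
rewrite antisym_0 // => /esym/eqP.
by rewrite scaler_eq0 (negbTE v0) orbF (negbTE card_col_stab_neq0).
Qed.

(** Each vector $u_i$ defines the linear map $a\mapsto u_ia$ on the group algebra.
    The second map is onto by irreducibility, and its kernel contains that of
    the first one. *)
Lemma garnir_dim_leq d1 d2 (rG1 : mx_representation k [set: 'S_r] d1)
    (rG2 : mx_representation k [set: 'S_r] d2)
    (u1 : 'rV[k]_d1) (u2 : 'rV[k]_d2) :
    mx_irreducible rG2 -> u1 != 0 -> u2 != 0 ->
    garnir col (fun s w => w *m rG1 s) u1 ->
    garnir col (fun s w => w *m rG2 s) u2 ->
  (d2 <= d1)%N.
Proof.
move=> irr u10 u20 g1 g2; have [_ _ simple] := irr.
pose M d (rG : mx_representation k [set: 'S_r] d) (u : 'rV[k]_d) :=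
  \matrix_(i < #|{: 'S_r}|, j < d) (u *m rG (enum_val i)) 0 j.
have rowM d (rG : mx_representation k [set: 'S_r] d) u s :
    row (enum_rank s) (M d rG u) = u *m rG s.
  by apply/rowP => j; rewrite !mxE enum_rankK.
have ME d (rG : mx_representation k [set: 'S_r] d) u (x : 'rV[k]_#|{: 'S_r}|) :
    x *m M d rG u = \sum_s x 0 (enum_rank s) *: (u *m rG s).
  rewrite mulmx_sum_row (reindex enum_rank) /=; last first.
    by exists enum_val => i _; rewrite ?enum_valK ?enum_rankK.
  by apply: eq_bigr => s _; rewrite rowM.
have full : \rank (M _ rG2 u2) = d2.
  apply/eqP; change (row_full (M _ rG2 u2)); rewrite -sub1mx.
  apply: (submx_trans (B := cyclic_mx rG2 u2)) => [|]; last first.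
    apply/rV_subP => v /cyclic_mxP [A /envelop_mxP [b ->] ->].
    rewrite mulmx_sumr; apply: summx_sub => s _; rewrite -scalemxAr scalemx_sub //.
    by rewrite -rowM row_sub.
  by apply: simple; rewrite ?cyclic_mx_module ?submx1 ?cyclic_mx_eq0.
rewrite -full; apply: leq_trans (rank_leq_col (M _ rG1 u1)).
have : (kermx (M _ rG1 u1) <= kermx (M _ rG2 u2))%MS.
  apply/rV_subP => x /sub_kermxP; rewrite ME => e; apply/sub_kermxP; rewrite ME.
  exact: (garnir_ann irr g2 (repr_right_action rG1) g1 u10 e).
move/mxrankS; rewrite !mxrank_ker => le.
have := rank_leq_row (M _ rG1 u1); have := rank_leq_row (M _ rG2 u2).
move: le; set a := \rank _; set b := \rank _; move: #|_| => n le bn an.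
by rewrite -(leq_sub2lE (m := n)) //.
Qed.

Lemma garnir_irr_dim d1 d2 (rG1 : mx_representation k [set: 'S_r] d1)
    (rG2 : mx_representation k [set: 'S_r] d2)
    (u1 : 'rV[k]_d1) (u2 : 'rV[k]_d2) :
    mx_irreducible rG1 -> mx_irreducible rG2 -> u1 != 0 -> u2 != 0 ->
    garnir col (fun s w => w *m rG1 s) u1 ->
    garnir col (fun s w => w *m rG2 s) u2 ->
  d1 = d2.
Proof.
move=> i1 i2 u10 u20 g1 g2; apply/eqP; rewrite eqn_leq.
by rewrite (garnir_dim_leq i1 u20 u10 g2 g1) (garnir_dim_leq i2 u10 u20 g1 g2).
Qed.

End GarnirVectors.

(** * Representations of the symmetric group from the Coxeter relations *)

(** The group operation is a parameter because the normal form is used twice: for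
    permutations, where it is unique, and for matrices. *)
Section CoxeterNormalForm.

Variables (G : Type) (one : G) (mul : G -> G -> G).
Local Infix "**" := mul (at level 40, left associativity).
Hypotheses (mulA : forall x y z, x ** (y ** z) = x ** y ** z)
  (mul1x : forall x, one ** x = x) (mulx1 : forall x, x ** one = x).

Definition coxeter_relations (r : nat) (T : nat -> G) : Prop :=
  [/\ forall a, (a.+1 < r)%N -> T a ** T a = one,
      forall a, (a.+2 < r)%N ->
        T a ** T a.+1 ** T a = T a.+1 ** T a ** T a.+1 &
      forall a b, (a.+1 < b)%N -> (b.+1 < r)%N -> T a ** T b = T b ** T a].

Variables (r : nat) (T : nat -> G).

(** $T_{n-1}T_{n-2}\cdots T_j$, a coset representative of $S_n$ in $S_{n+1}$. *)
Fixpoint descent (n j : nat) : G :=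
  if n is n'.+1 then if (j <= n')%N then T n' ** descent n' j else one else one.

(** An element of $S_{n+1}$ is a product of an element of $S_n$ and a coset
    representative; a code lists the indices of the representatives, that of the
    largest group first. *)
Fixpoint code_eval (c : seq nat) : G :=
  if c is j :: c' then code_eval c' ** descent (size c') j else one.

Hypothesis cox : coxeter_relations r T.

Lemma descent_ge n j : (n <= j)%N -> descent n j = one.
Proof. by case: n => //= n; rewrite ltnNge => /negbTE ->. Qed.

Lemma descentSr n j : (j < n)%N -> descent n j = descent n j.+1 ** T j.
Proof.
elim: n => // n IHn; rewrite ltnS leq_eqVlt => /orP [/eqP ->|lt] /=.
  by rewrite leqnn ltnn descent_ge // mul1x mulx1.
by rewrite ltnW // lt IHn // mulA.
Qed.

Lemma descent_commute n j a : (n < r)%N -> (a.+1 < j)%N ->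
  descent n j ** T a = T a ** descent n j.
Proof.
case: cox => _ _ comm; elim: n => [|n IHn] nr aj /=; first by rewrite mul1x mulx1.
case: leqP => jn; last by rewrite mul1x mulx1.
by rewrite -mulA IHn // 1?ltnW // !mulA (comm a) //; apply: leq_trans jn.
Qed.

Lemma commute_descent n j a : (n < a)%N -> (a.+1 < r)%N ->
  descent n j ** T a = T a ** descent n j.
Proof.
case: cox => _ _ comm; elim: n => [|n IHn] na ar /=; first by rewrite mul1x mulx1.
case: leqP => jn; last by rewrite mul1x mulx1.
by rewrite -mulA IHn // 1?ltnW // !mulA (comm n a).
Qed.

(** The only place where the braid relation enters: $T_{a+1}$ moves through the
    descending product and comes out as $T_a$. *)
Lemma descent_shift n j a : (n < r)%N -> (j <= a)%N -> (a.+1 < n)%N ->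
  descent n j ** T a.+1 = T a ** descent n j.
Proof.
case: cox => _ braid comm; elim: n => // n IHn nr ja; rewrite ltnS leq_eqVlt.
case/orP => [/eqP en|lt]; last first.
  have jn : (j <= n)%N by apply: leq_trans ja _; apply: ltnW; apply: ltnW.
  rewrite /= jn -mulA IHn // 1?ltnW // !mulA (comm a n) //.
rewrite -{}en /= in nr *; rewrite (leqW ja) ja -!mulA commute_descent //.
by rewrite !mulA braid.
Qed.

End CoxeterNormalForm.

Fixpoint code_valid (c : seq nat) : bool :=
  if c is j :: c' then (j <= size c')%N && code_valid c' else true.

(** The effect on codes of a multiplication by $T_a$ on the right. It does not
    depend on the group in which the code is evaluated. *)
Fixpoint code_mul (a : nat) (c : seq nat) : seq nat :=
  if c is j :: c' then
    if a.+1 == j then a :: c' else if a == j then a.+1 :: c'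
    else if (a < j)%N then j :: code_mul a c' else j :: code_mul a.-1 c'
  else [::].

Lemma size_code_mul a c : size (code_mul a c) = size c.
Proof. by elim: c a => //= j c IHc a; do 3![case: ifP => _ //=]; rewrite IHc. Qed.

Lemma code_mul_valid a c :
  (a.+1 < size c)%N -> code_valid c -> code_valid (code_mul a c).
Proof.
elim: c a => //= j c IHc a; rewrite ltnS => ac /andP [jc vc].
case: (eqVneq a.+1 j) => [_|n1] /=; first by rewrite vc ltnW.
case: (eqVneq a j) => [_|n2] /=; first by rewrite vc ac.
by case: ltnP => aj /=; rewrite size_code_mul jc /= IHc //; lia.
Qed.

Section CodeProduct.

Variables (G : Type) (one : G) (mul : G -> G -> G).
Hypotheses (mulA : forall x y z, mul x (mul y z) = mul (mul x y) z)
  (mul1x : forall x, mul one x = x) (mulx1 : forall x, mul x one = x).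
Variables (r : nat) (T : nat -> G).
Hypothesis cox : coxeter_relations one mul r T.

Lemma code_eval_mul a c : code_valid c -> (size c <= r)%N -> (a.+1 < size c)%N ->
  mul (code_eval one mul T c) (T a) = code_eval one mul T (code_mul a c).
Proof.
elim: c a => //= j c IHc a /andP [jc vc] cr; rewrite ltnS => ac.
have [sq _ _] := cox; have nr : (size c < r)%N by [].
case: (eqVneq a.+1 j) => [<-|n1] /=; first by rewrite -mulA -descentSr.
case: (eqVneq a j) => [<-|n2] /=.
  rewrite (descentSr mulA mul1x mulx1) // -!mulA sq ?mulx1 //; lia.
case: ltnP => aj /=; rewrite size_code_mul.
  rewrite -IHc //; [|lia|lia].
  by rewrite -!mulA (descent_commute mulA mul1x mulx1 cox) //; lia.
case: a ac n1 n2 aj => [|a] ac n1 n2 aj /=; first lia.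
rewrite -IHc //; [|lia].
by rewrite -!mulA (descent_shift mulA mul1x mulx1 cox) //; lia.
Qed.

Lemma code_eval_trivial m : code_eval one mul T (rev (iota 0 m)) = one.
Proof.
elim: m => // m IHm; rewrite -addn1 iotaD rev_cat /= IHm mul1x.
by rewrite descent_ge // size_rev size_iota.
Qed.

End CodeProduct.

Definition adjacent r (a : nat) : 'S_r :=
  match insub a, insub a.+1 with
  | Some x, Some y => tperm x y
  | _, _ => 1%g
  end.

Lemma adjacentE r (x y : 'I_r) : y = x.+1 :> nat -> adjacent r x = tperm x y.
Proof.
by move=> e; rewrite /adjacent -e; do 2!rewrite insubT //= => ?; congr tperm;
  apply: val_inj.
Qed.

Section SymmetricGroup.

Variable r : nat.

Lemma adjacent_cox : coxeter_relations 1%g (@mulg 'S_r) r (adjacent r).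
Proof.
split=> [a ar|a ar|a b ab br].
- by rewrite (@adjacentE r (Ordinal (ltnW ar)) (Ordinal ar)) // tperm2.
- pose x := Ordinal (ltnW (ltnW ar)); pose y := Ordinal (ltnW ar); pose z := Ordinal ar.
  rewrite (@adjacentE r x y) // (@adjacentE r y z) //.
  have e1 : (tperm y z ^ tperm x y)%g = tperm x z.
    by rewrite tpermJ tpermR tpermD // -val_eqE /=; lia.
  have e2 : (tperm x y ^ tperm y z)%g = tperm x z.
    by rewrite tpermJ tpermL tpermD // -val_eqE /=; lia.
  by move: e1; rewrite -e2 !conjgE !tpermV !mulgA.
- have ar : (a.+1 < r)%N by lia.
  rewrite (@adjacentE r (Ordinal (ltnW ar)) (Ordinal ar)) //.
  rewrite (@adjacentE r (Ordinal (ltnW br)) (Ordinal br)) //.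
  rewrite [RHS]conjgC tpermJ !tpermD //; rewrite -val_eqE /=; lia.
Qed.

Lemma adjacent_ind (Q : 'S_r -> Prop) :
    Q 1%g -> (forall s a, (a.+1 < r)%N -> Q s -> Q (s * adjacent r a)%g) ->
  forall s, Q s.
Proof.
move=> Q1 Qadj s.
have Qt u x y : Q u -> Q (u * tperm x y)%g.
  wlog xy : x y / (x <= y)%N => [H|]; first by case: (leqP x y) => [|/ltnW] /H //;
    rewrite tpermC.
  have [d ed] : {d | (y = x + d :> nat)%N} by exists (y - x)%N; lia.
  elim: d y ed u {xy} => [|d IHd] y ed u Qu.
    have -> : y = x by apply: val_inj; rewrite /= ed addn0.
    by rewrite tperm1 mulg1.
  have yr := ltn_ord y; have zr : (x + d < r)%N by lia.
  pose z := Ordinal zr; have adjE : adjacent r z = tperm z y by apply: adjacentE;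
    rewrite ed addnS.
  have [dz|dp] := posnP d.
    have <- : z = x by apply: val_inj; rewrite /= dz addn0.
    by rewrite -adjE; apply: Qadj => //=; lia.
  have -> : tperm x y = (adjacent r z * tperm x z * adjacent r z)%g.
    rewrite adjE -{1}(tpermV z y) -mulgA -conjgE tpermJ tpermL tpermD //;
      rewrite -val_eqE /=; lia.
  rewrite !mulgA; apply: (Qadj); first by rewrite /=; lia.
  by apply: (IHd z) => //; apply: Qadj => //=; lia.
have [ts -> _] := prod_tpermP s.
suff H u : Q u -> Q (u * \prod_(t <- ts) tperm t.1 t.2)%g by rewrite -[X in Q X]mul1g;
  apply: H.
elim: ts u => [|t ts IHts] u Qu.
  by rewrite big_nil mulg1.
by rewrite big_cons mulgA; apply: IHts; apply: Qt.
Qed.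

Notation word_of_code := (code_eval 1%g (@mulg 'S_r) (adjacent r)).

Lemma adjacent_fix a (x : 'I_r) : (a.+1 < x)%N -> adjacent r a x = x.
Proof.
rewrite /adjacent => ax; case: insubP => [y _ ey|]; last by rewrite perm1.
case: insubP => [z _ ez|]; last by rewrite perm1.
by apply: tpermD; rewrite -val_eqE /= ?ey ?ez; lia.
Qed.

Lemma descent_fix n j (x : 'I_r) : (n < x)%N ->
  descent 1%g (@mulg 'S_r) (adjacent r) n j x = x.
Proof.
elim: n => [|n IHn] nx /=; first by rewrite perm1.
by case: ifP; rewrite ?perm1 // permM adjacent_fix // IHn // ltnW.
Qed.

Lemma code_eval_fix c (x : 'I_r) : (size c <= x)%N -> word_of_code c x = x.
Proof.
by elim: c => [|j c IHc] cx /=; rewrite ?perm1 // permM IHc 1?ltnW // descent_fix.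
Qed.

Lemma descent_top (n j : nat) (x : 'I_r) : n = x :> nat -> (j <= n)%N ->
  descent 1%g (@mulg 'S_r) (adjacent r) n j x = j :> nat.
Proof.
elim: n x => [|n IHn] x nx jn /=; first by rewrite perm1; lia.
case: leqP => jn'; last by rewrite perm1; lia.
have xr := ltn_ord x; have yr : (n < r)%N by lia.
rewrite permM (@adjacentE r (Ordinal yr) x) //= tpermR; exact: IHn.
Qed.

(** The first entry of a code is the image of the last point, because the rest of
    the code fixes that point. *)
Lemma code_eval_inj c d : (size c <= r)%N -> size c = size d ->
    code_valid c -> code_valid d -> word_of_code c = word_of_code d -> c = d.
Proof.
elim: c d => [|j c IHc] [|i d] //= cr [cd] /andP [jc vc] /andP [id vd] e.
have ji : j = i.
  move/permP/(_ (Ordinal cr))/(congr1 val): e; rewrite !permM.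
  rewrite !code_eval_fix /= ?cd // -?cd.
  by rewrite (descent_top (x := Ordinal cr)) // (descent_top (x := Ordinal cr)) // cd.
rewrite -ji in e *; congr (_ :: _); apply: IHc => //; first exact: ltnW.
by move: e; rewrite cd; apply: mulIg.
Qed.

Lemma code_exists s : exists c,
  [&& code_valid c, size c == r & word_of_code c == s].
Proof.
elim/adjacent_ind: s => [|s a ar [c /and3P [vc /eqP sc /eqP es]]].
  exists (rev (iota 0 r)); rewrite size_rev size_iota eqxx code_eval_trivial ?eqxx ?andbT
    //; last exact: mul1g.
  elim: r => // m IHm; rewrite -addn1 iotaD rev_cat /= IHm size_rev size_iota.
  by rewrite add0n leqnn.
exists (code_mul a c); rewrite size_code_mul sc eqxx code_mul_valid ?sc //=.
by rewrite -es -(code_eval_mul (@mulgA _) (@mul1g _) (@mulg1 _) adjacent_cox) ?sc.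
Qed.

(** A permutation is sent to the value at $T$ of its unique code. Multiplying by an
    adjacent transposition changes the code in the same way for permutations and
    for matrices, so this map is multiplicative. *)
Theorem coxeter_repr (k : fieldType) N (T : nat -> 'M[k]_N) :
    coxeter_relations 1%:M mulmx r T ->
  exists rG : mx_representation k [set: 'S_r] N,
    forall a b : 'I_r, b = a.+1 :> nat -> rG (tperm a b) = T a.
Proof.
move=> cox; pose code s := xchoose (code_exists s).
have codeP s : [/\ code_valid (code s), size (code s) = r & word_of_code (code s) = s].
  by have /and3P [? /eqP ? /eqP ?] := xchooseP (code_exists s).
pose rho s := code_eval 1%:M mulmx T (code s).
have code_eq s c : code_valid c -> size c = r -> word_of_code c = s -> code s = c.
  move=> vc sc es; have [vs ss e] := codeP s.
  by apply: code_eval_inj; rewrite ?ss // es.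
have rho1 : rho 1%g = 1%:M.
  rewrite /rho (code_eq _ (rev (iota 0 r))) ?size_rev ?size_iota //.
  - by apply: code_eval_trivial; apply: mul1mx.
  - elim: (r) => // m IHm; rewrite -addn1 iotaD rev_cat /= IHm size_rev size_iota.
    by rewrite add0n leqnn.
  - by apply: code_eval_trivial; apply: mul1g.
have rho_adj s a : (a.+1 < r)%N -> rho (s * adjacent r a)%g = rho s *m T a.
  move=> ar; have [vs ss e] := codeP s.
  rewrite /rho (code_eq _ (code_mul a (code s))) ?size_code_mul //.
  - by rewrite -(code_eval_mul (@mulmxA _ _ _ _ _) (@mul1mx _ _ _)
    (@mulmx1 _ _ _) cox) // ss.
  - by apply: code_mul_valid; rewrite ?ss.
  - by rewrite -(code_eval_mul (@mulgA _) (@mul1g _) (@mulg1 _) adjacent_cox) ?ss // e.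
have rho_repr : mx_repr [set: 'S_r] rho.
  split=> // s t _ _; elim/adjacent_ind: t => [|t a ar IH];
    first by rewrite mulg1 rho1 mulmx1.
  by rewrite mulgA !rho_adj // IH mulmxA.
exists (MxRepresentation rho_repr) => a b e /=.
by rewrite -(adjacentE e) -[adjacent r a]mul1g rho_adj -?e // rho1 mul1mx.
Qed.

End SymmetricGroup.

(** * Walks in the bottom alcove *)

Section Alcove.

Variables (k : fieldType) (p : nat) (n : nat).
Hypotheses (hp : p \in [pchar k]) (np : (n.+1 < p)%N).

Notation weight := 'rV[int]_n.+1.
Notation letter := 'I_n.+1.
Notation alcove := (@bottom_alcove p n).
Notation eps i := (delta_mx 0 i : weight).

Lemma epsE (mu : weight) i j : (mu + eps i) 0 j = mu 0 j + (j == i)%:Z.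
Proof. by rewrite !mxE eqxx; case: eqP. Qed.

Lemma alcoveP (mu : weight) : reflect
  ((forall i j : letter, (i <= j)%N -> mu 0 j <= mu 0 i) /\
   (n = 0%N \/ mu 0 ord0 - mu 0 ord_max <= p%:Z - n.+1%:Z)) (alcove mu).
Proof.
apply: (iffP andP) => [[/'forall_forallP h1 h2]|[h1 h2]]; split.
- by move=> i j; apply/implyP/h1.
- by case/orP: h2 => [/eqP|]; [left|right].
- by apply/'forall_forallP => i j; apply/implyP/h1.
- by apply/orP; case: h2 => [/eqP|]; [left|right].
Qed.

(** The residue of the box that the step $\epsilon_i$ adds to $\mu$. *)
Definition content (mu : weight) (i : letter) : k := (mu 0 i - i%:Z)%:~R.

Lemma intr_small_neq0 (z : int) : 0 < z -> z < p%:Z -> z%:~R != 0 :> k.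
Proof.
case: z => z z0 zp; last by lia.
by rewrite -pmulrn; apply: (natr_neq0_small hp); lia.
Qed.

Lemma content_eps mu i j : content (mu + eps i) j = content mu j + (j == i)%:R.
Proof. by rewrite /content epsE addrAC [LHS]intrD -pmulrn. Qed.

(** The strictly decreasing integers $\mu_i-i$ lie in an interval of length at
    most $p-1$. *)
Lemma alcove_content_inj mu i j :
  alcove mu -> i != j -> content mu i - content mu j != 0.
Proof.
move/alcoveP => [dom wall].
wlog lt_ij : i j / (i < j)%N => [H ij|_].
  have : (i < j)%N || (j < i)%N by rewrite -neq_ltn.
  by case/orP => lt; [|rewrite -opprB oppr_eq0]; apply: H => //; rewrite eq_sym.
rewrite /content -intrB; have jn := ltn_ord j.
have h1 := dom ord0 i (leq0n _); have h2 := dom j ord_max (leq_ord _).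
have h3 := dom i j (ltnW lt_ij).
by apply: intr_small_neq0; case: wall => ?; lia.
Qed.

(** Two cases. If $\mu+\epsilon_j$ is not dominant, then $j=i+1$ and $\mu_i=\mu_j$.
    If it violates the upper wall, then $i$ is the last and $j$ the first index,
    $\mu_1-\mu_m=p-m$, and the difference of residues is $p-1$. *)
Lemma leaving_alcove mu i j : alcove mu -> alcove (mu + eps i) ->
    alcove (mu + eps i + eps j) -> i != j -> ~~ alcove (mu + eps j) ->
  content mu j - content mu i = - 1.
Proof.
move=> /alcoveP [dom wall] /alcoveP [domi walli] /alcoveP [domij wallij] ij.
case: (boolP [forall a : letter, forall b : letter,
    (a <= b)%N ==> ((mu + eps j) 0 b <= (mu + eps j) 0 a)]) => [domj|].
  rewrite /bottom_alcove [dominant _]domj /= negb_or => /andP [n0].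
  have {}wall : mu 0 ord0 - mu 0 ord_max <= p%:Z - n.+1%:Z.
    by case: wall => // e; rewrite e in n0.
  have {}wallij : (mu + eps i + eps j) 0 ord0 - (mu + eps i + eps j) 0 ord_max
      <= p%:Z - n.+1%:Z by case: wallij => // e; rewrite e in n0.
  rewrite !epsE in wallij *; have ne : ((ord_max : letter) == ord0) = false.
    by apply/negbTE; rewrite -val_eqE.
  rewrite -ltNge => out.
  have ej : ord0 = j by apply/eqP; move: out; case: eqP => //; case: eqP; lia.
  have ei : ord_max = i.
    apply/eqP; move: wallij out; rewrite -ej ne eqxx.
    by case: eqP; case: eqP; lia.
  rewrite -ej -ei /content -intrB.
  have -> : mu 0 ord0 - (ord0 : letter)%:Z - (mu 0 ord_max - (ord_max
    : letter)%:Z) = p%:Z - 1.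
    move: out; rewrite -ej ne eqxx /=; lia.
  by rewrite intrB -pmulrn (pcharf0 hp) sub0r.
rewrite negb_forall => /existsP [a]; rewrite negb_forall => /existsP [b].
rewrite negb_imply => /andP [ab]; rewrite -ltNge !epsE => lt _.
have := dom _ _ ab; have := domij _ _ ab; rewrite !epsE => le1 le2.
have eb : b = j by apply/eqP; move: lt le2; case: eqP => //; case: eqP; lia.
have ji : (j == i) = false by rewrite eq_sym (negbTE ij).
rewrite eb in ab lt le1 le2; rewrite eqxx ?ji in lt le1.
have ea : a = i.
  by apply/eqP; move: lt le1 le2; case: eqP => // _; case: eqP; lia.
have emu : mu 0 j = mu 0 i by move: lt le2; rewrite ea (negbTE ij); lia.
rewrite ea in ab => {lt le1 le2}.
have eij : j = i.+1 :> nat.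
  apply/eqP; rewrite eqn_leq andbC ltn_neqAle ab andbT [_ == _](negbTE ij) //=.
  rewrite leqNgt; apply/negP => lt_ij.
  have cr : (i.+1 < n.+1)%N by have := ltn_ord j; lia.
  have := domij (Ordinal cr) j (ltnW lt_ij); have := dom i (Ordinal cr) (leqnSn i).
  rewrite !epsE eqxx -!val_eqE /= (negbTE (_ : j != i :> nat)) 1?eq_sym //.
  by do 2?[case: eqP]; lia.
rewrite /content -intrB.
have -> : mu 0 j - j%:Z - (mu 0 i - i%:Z) = -1 by lia.
by rewrite mulrN1z.
Qed.

Definition wt (w : seq letter) : weight := \sum_(i <- w) eps i.

Lemma wt_nil : wt [::] = 0. Proof. exact: big_nil. Qed.
Lemma wt_cat u v : wt (u ++ v) = wt u + wt v. Proof. exact: big_cat. Qed.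
Lemma wt_cons i v : wt (i :: v) = eps i + wt v. Proof. exact: big_cons. Qed.
Lemma wt_rcons u i : wt (rcons u i) = wt u + eps i.
Proof. by rewrite -cats1 wt_cat wt_cons wt_nil addr0. Qed.

Lemma wtE w i : wt w 0 i = (count_mem i w)%:Z.
Proof.
elim: w => [|j w IHw]; first by rewrite wt_nil mxE.
by rewrite wt_cons addrC epsE IHw /= PoszD addrC eq_sym.
Qed.

Fixpoint alcove_walk (mu : weight) (w : seq letter) : bool :=
  alcove mu && (if w is i :: w' then alcove_walk (mu + eps i) w' else true).

Lemma alcove_walk_cat mu u v :
  alcove_walk mu (u ++ v) = alcove_walk mu u && alcove_walk (mu + wt u) v.
Proof.
elim: u mu => [|i u IHu] mu /=.
  by rewrite wt_nil addr0 andbT; case: v => [|i v] /=; case: bottom_alcove.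
by rewrite IHu wt_cons addrA andbA.
Qed.

Lemma alcove_walk_start mu w : alcove_walk mu w -> alcove mu.
Proof. by case: w => [|i w] /andP []. Qed.

Lemma alcove_walk_end mu w : alcove_walk mu w -> alcove (mu + wt w).
Proof. by rewrite -{1}[w]cats0 alcove_walk_cat => /andP [_ /alcove_walk_start]. Qed.

Lemma alcove_walk_rcons mu u i :
  alcove_walk mu (rcons u i) = alcove_walk mu u && alcove (mu + wt u + eps i).
Proof.
rewrite -cats1 alcove_walk_cat /= andbT; case: (boolP (alcove_walk mu u)) => //= h.
by rewrite (alcove_walk_end h).
Qed.

(** * The seminormal representation *)

Section Seminormal.

Variables (r : nat) (la : weight).

Definition walk_to (w : seq letter) : bool :=
  [&& size w == r, alcove_walk 0 w & wt w == la].

Definition walks : {set r.-tuple letter} := [set w : r.-tuple letter | walk_to w].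

Notation N := #|walks|.

Definition walk_of (x : 'I_N) : seq letter := tval (enum_val x).

(** The basis vector of a walk; words that are not walks give the zero vector, so
    that formulas need no side condition. *)
Definition walk_vec (w : seq letter) : 'rV[k]_N :=
  \row_x (walk_of x == w)%:R.

Definition seminormal_row (a : nat) (w : seq letter) : 'rV[k]_N :=
  if drop a w is i :: j :: v then
    if i == j then walk_vec w
    else let d := content (wt (take a w)) j - content (wt (take a w)) i in
      d^-1 *: walk_vec w + (1 - d^-1) *: walk_vec (take a w ++ j :: i :: v)
  else walk_vec w.

Definition seminormal (a : nat) : 'M[k]_N :=
  \matrix_x seminormal_row a (walk_of x).

Lemma walk_to_of (x : 'I_N) : walk_to (walk_of x).
Proof. by have := enum_valP x; rewrite inE. Qed.

Lemma walk_to_enum w : walk_to w -> exists x : 'I_N, walk_of x = w.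
Proof.
move=> hw; have /andP [sw _] := hw.
have wB : Tuple sw \in walks by rewrite inE.
by exists (enum_rank_in wB (Tuple sw)); rewrite /walk_of enum_rankK_in.
Qed.

Lemma walk_vec_enum (x : 'I_N) : walk_vec (walk_of x) = delta_mx 0 x.
Proof.
apply/rowP => y; rewrite !mxE eqxx /= (inj_eq val_inj).
by rewrite (inj_eq (@enum_val_inj _ _)).
Qed.

Lemma walk_vec0 w : ~~ walk_to w -> walk_vec w = 0.
Proof.
move=> hw; apply/rowP => y; rewrite !mxE; case: eqP => // e.
by rewrite -e walk_to_of in hw.
Qed.

Lemma walk_vec_neq0 w : walk_to w -> walk_vec w != 0.
Proof.
move=> /walk_to_enum [x <-]; rewrite walk_vec_enum; apply/eqP => /rowP /(_ x) /eqP.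
by rewrite !mxE !eqxx oner_eq0.
Qed.

Lemma walk_vec_ext (A B : 'M[k]_N) :
  (forall w, walk_to w -> walk_vec w *m A = walk_vec w *m B) -> A = B.
Proof.
move=> h; apply/row_matrixP => x; rewrite !rowE -walk_vec_enum.
exact/h/walk_to_of.
Qed.

Lemma walk_to_alcove u v : walk_to (u ++ v) -> alcove (wt u).
Proof.
by case/and3P => _; rewrite alcove_walk_cat => /andP [/alcove_walk_end]; rewrite add0r.
Qed.

Lemma walk_to_swap u i j v : walk_to (u ++ i :: j :: v) ->
  walk_to (u ++ j :: i :: v) = alcove (wt u + eps j).
Proof.
rewrite /walk_to !size_cat /= !alcove_walk_cat /= !wt_cat !wt_cons !add0r.
case/and3P => -> /andP [-> /and3P [-> ai aij]] /=.
by rewrite (addrCA (eps j)) => ->; rewrite andbT (addrAC _ (eps j)) aij andbT.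
Qed.

(** For a walk, an exchange that does not give a walk leaves the alcove after its
    first step, since all the other weights are unchanged. *)
Lemma walk_swap_diff u i j v : walk_to (u ++ i :: j :: v) -> i != j ->
  ~~ walk_to (u ++ j :: i :: v) -> content (wt u) j - content (wt u) i = -1.
Proof.
move=> hw ij; rewrite (walk_to_swap hw) => nj.
have /and3P [_] := hw; rewrite alcove_walk_cat add0r => /andP [_ /=].
case/and3P => a1 a2 /alcove_walk_start a3 _; exact: leaving_alcove a1 a2 a3 ij nj.
Qed.

(** The coefficient $1-d^{-1}$ vanishes exactly on the pairs in which the
    exchanged word is a walk but the word itself is not; hence the formula
    also holds, as $0 = 0$, for words that are not walks. *)
Lemma seminormalE u i j v : i != j ->
  let d := content (wt u) j - content (wt u) i in
  walk_vec (u ++ i :: j :: v) *m seminormal (size u) =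
  d^-1 *: walk_vec (u ++ i :: j :: v) +
  (1 - d^-1) *: walk_vec (u ++ j :: i :: v).
Proof.
move=> ij d; case: (boolP (walk_to (u ++ i :: j :: v))) => hw.
  have [x ex] := walk_to_enum hw.
  rewrite -{1}ex walk_vec_enum -rowE rowK ex /seminormal_row.
  by rewrite drop_size_cat // take_size_cat // (negbTE ij).
rewrite walk_vec0 // mul0mx scaler0 add0r.
case: (boolP (walk_to (u ++ j :: i :: v))) => hw'; last by rewrite walk_vec0 ?scaler0.
have ji : j != i by rewrite eq_sym.
have := walk_swap_diff hw' ji hw; rewrite -opprB -/d => /oppr_inj ->.
by rewrite invr1 subrr scale0r.
Qed.

Lemma seminormal_same u i v :
  walk_vec (u ++ i :: i :: v) *m seminormal (size u) = walk_vec (u ++ i :: i :: v).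
Proof.
case: (boolP (walk_to (u ++ i :: i :: v))) => hw; last by rewrite walk_vec0 ?mul0mx.
have [x ex] := walk_to_enum hw.
by rewrite -{1}ex walk_vec_enum -rowE rowK ex /seminormal_row drop_size_cat // eqxx.
Qed.

Lemma split_at2 a (w : seq letter) : (a.+1 < size w)%N ->
  exists u i j v, size u = a /\ w = u ++ i :: j :: v.
Proof.
move=> lt; have es := size_drop a w; have ew := cat_take_drop a w.
case: (drop a w) es ew => [|i [|j v]] /= es ew; [exfalso; lia|exfalso; lia|].
exists (take a w), i, j, v; rewrite ew; split=> //; rewrite size_takel //; lia.
Qed.

Lemma seminormal_sq a : (a.+1 < r)%N -> seminormal a *m seminormal a = 1%:M.
Proof.
move=> ar; apply: walk_vec_ext => w hw; rewrite mulmx1.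
have /andP [/eqP sw _] := hw.
have [|u [i [j [v [su ew]]]]] := @split_at2 a w; first by rewrite sw.
rewrite -{}su {}ew in hw *; rewrite mulmxA.
case: (eqVneq i j) => [<-|ij]; first by rewrite !seminormal_same.
have ji : j != i by rewrite eq_sym.
rewrite seminormalE // mulmxDl -!scalemxAl !seminormalE //.
have d0 := alcove_content_inj (walk_to_alcove hw) ji.
move: (content _ j) (content _ i) d0 => y x d0.
have d0' : x - y != 0 by rewrite -opprB oppr_eq0.
move: (walk_vec _) (walk_vec _) => E F.
by apply/rowP => q; rewrite !mxE; field; rewrite d0 d0'.
Qed.

Lemma seminormal_comm a b : (a.+1 < b)%N -> (b.+1 < r)%N ->
  seminormal a *m seminormal b = seminormal b *m seminormal a.
Proof.
move=> ab br; apply: walk_vec_ext => w hw.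
have /andP [/eqP sw _] := hw.
have [|u [i [j [s [su ew]]]]] := @split_at2 a w; first by rewrite sw; lia.
have [|t [i' [j' [v [st es]]]]] := @split_at2 (b - a.+2) s.
  by move: sw; rewrite ew size_cat su /=; lia.
have sb x y : size (u ++ x :: y :: t) = b by rewrite size_cat su /= st; lia.
have assoc x y x' y' : u ++ x :: y :: t ++ x' :: y' :: v =
    (u ++ x :: y :: t) ++ x' :: y' :: v by rewrite -catA.
have wtC : wt (u ++ j :: i :: t) = wt (u ++ i :: j :: t).
  by rewrite !wt_cat !wt_cons (addrCA (eps j)).
have Sb x y z : walk_vec (u ++ x :: y :: t ++ z :: z :: v) *m seminormal b =
    walk_vec (u ++ x :: y :: t ++ z :: z :: v).
  by rewrite assoc -(sb x y) seminormal_same.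
have Sb' x y : i' != j' -> walk_vec (u ++ x :: y :: t ++ i' :: j' :: v) *m seminormal b =
    let d := content (wt (u ++ x :: y :: t)) j' - content (wt (u ++ x :: y :: t)) i' in
    d^-1 *: walk_vec (u ++ x :: y :: t ++ i' :: j' :: v) +
    (1 - d^-1) *: walk_vec (u ++ x :: y :: t ++ j' :: i' :: v).
  by move=> ij'; rewrite !assoc -(sb x y) seminormalE.
rewrite {}ew {}es in hw *; rewrite !mulmxA -su.
case: (eqVneq i j) => [<-|ij]; case: (eqVneq i' j') => [<-|ij'].
- by rewrite !(seminormal_same, Sb).
- by rewrite seminormal_same !Sb' //= mulmxDl -!scalemxAl !seminormal_same.
- by rewrite seminormalE // mulmxDl -!scalemxAl !Sb seminormalE.
rewrite seminormalE // mulmxDl -!scalemxAl !Sb' //= mulmxDl -!scalemxAl.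
rewrite !seminormalE // wtC.
move: (walk_vec _) (walk_vec _) (walk_vec _) (walk_vec _) => E1 E2 E3 E4.
by apply/rowP => q; rewrite !mxE; ring.
Qed.

Lemma seminormalE_next u h i j v : i != j ->
  let d := content (wt u + eps h) j - content (wt u + eps h) i in
  walk_vec (u ++ h :: i :: j :: v) *m seminormal (size u).+1 =
  d^-1 *: walk_vec (u ++ h :: i :: j :: v) +
  (1 - d^-1) *: walk_vec (u ++ h :: j :: i :: v).
Proof. by move=> ij; rewrite -!(cat_rcons h) -(size_rcons u h) seminormalE // wt_rcons. Qed.

Lemma seminormal_same_next u h i v :
  walk_vec (u ++ h :: i :: i :: v) *m seminormal (size u).+1 =
  walk_vec (u ++ h :: i :: i :: v).
Proof. by rewrite -!(cat_rcons h) -(size_rcons u h) seminormal_same. Qed.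

Lemma mulmx_scale_left (a : k) (v : 'rV[k]_N) (A : 'M[k]_N) : a *: v *m A = a *: (v *m A).
Proof. by rewrite scalemxAl. Qed.

(** The conditions on the denominators are the distinctness of the residues at the
    weights before and after the three steps. *)
Lemma seminormal_braid a : (a.+2 < r)%N ->
  seminormal a *m seminormal a.+1 *m seminormal a =
  seminormal a.+1 *m seminormal a *m seminormal a.+1.
Proof.
move=> ar; apply: walk_vec_ext => w hw.
have /andP [/eqP sw _] := hw.
have [|u [i [j [s [su ew]]]]] := @split_at2 a w; first by rewrite sw; lia.
case: s ew => [|l v] ew.
  by exfalso; move: sw; rewrite ew size_cat su /=; lia.
rewrite {}ew in hw *; rewrite -{}su !mulmxA => {ar w sw}.
have alc0 := walk_to_alcove hw.
have alc1 : alcove (wt u + eps i).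
  by rewrite -wt_rcons; apply: (@walk_to_alcove _ (j :: l :: v)); rewrite cat_rcons.
have alc3 : alcove (wt u + eps i + eps j + eps l).
  rewrite -!wt_rcons -cats1 -cats1 -cats1 -!catA.
  by apply: (@walk_to_alcove _ v); rewrite -!catA.
case: (eqVneq i j) => [ij|ij]; case: (eqVneq j l) => [jl|jl].
- by rewrite -jl -ij !(seminormal_same, seminormal_same_next).
- rewrite -{j}ij in hw alc3 jl *; have lj : l != i by rewrite eq_sym.
  have := alcove_content_inj alc0 lj; have := alcove_content_inj alc1 lj.
  pose calc := (mulmxDl, mulmx_scale_left, seminormal_same, seminormal_same_next,
    seminormalE _ _ jl, seminormalE _ _ lj, seminormalE_next _ _ _ jl, seminormalE_next _
      _ _ lj).
  rewrite !calc.
  rewrite !content_eps !eqxx ?(negbTE lj) ?(negbTE jl) !addr0 /= ?mulr1n.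
  move: (content _ l) (content _ i) => z x;
    move: (walk_vec _) (walk_vec _) (walk_vec _) => E1 E2 E3 d1 d2.
  by apply/rowP => q; rewrite !mxE; field; rewrite d1 d2 -oppr_eq0 opprB d1.
- rewrite -{l}jl in hw alc3 *; have ji : j != i by rewrite eq_sym.
  have := alcove_content_inj alc0 ij.
  have : content (wt u) j + 1 - content (wt u) i != 0.
    apply: contraNneq (alcove_content_inj alc3 ij) => e; apply/eqP.
    rewrite !content_eps !eqxx !(negbTE ij, negbTE ji) /= !mulr1n.
    by transitivity (- (content (wt u) j + 1 - content (wt u) i)); [ring|rewrite e oppr0].
  pose calc := (mulmxDl, mulmx_scale_left, seminormal_same, seminormal_same_next,
    seminormalE _ _ ij, seminormalE _ _ ji, seminormalE_next _ _ _ ij, seminormalE_next _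
      _ _ ji).
  rewrite !calc !content_eps !eqxx ?(negbTE ij) ?(negbTE ji) !addr0 /= ?mulr1n.
  move: (content _ j) (content _ i) => z x;
    move: (walk_vec _) (walk_vec _) (walk_vec _) => E1 E2 E3 d1 d2.
  apply/rowP => q; rewrite !mxE; field.
  by rewrite d1 -[z - x]opprB oppr_eq0 d2.
case: (eqVneq i l) => [il|il].
  rewrite -{l}il in hw alc3 jl *.
  have := alcove_content_inj alc0 ij; have := alcove_content_inj alc1 ij.
  pose calc := (mulmxDl, mulmx_scale_left, seminormal_same, seminormal_same_next,
    seminormalE _ _ ij, seminormalE _ _ jl, seminormalE_next _ _ _ ij, seminormalE_next _
      _ _ jl).
  rewrite !calc !content_eps !eqxx ?(negbTE ij) ?(negbTE jl) !addr0 /= ?mulr1n.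
  move: (content _ j) (content _ i) => z x;
    move: (walk_vec _) (walk_vec _) (walk_vec _) => E1 E2 E3 d1 d2.
  apply/rowP => q; rewrite !mxE; field.
  by rewrite -[z - x]opprB -[z - _]opprB !oppr_eq0 d1 d2.
have [ji lj li] : [/\ j != i, l != j & l != i]
  by rewrite ![_ == i]eq_sym (eq_sym l) ij jl il.
have := alcove_content_inj alc0 ji; have := alcove_content_inj alc0 lj.
have := alcove_content_inj alc0 li.
pose calc := (mulmxDl, mulmx_scale_left,
  seminormalE _ _ ij, seminormalE _ _ ji, seminormalE _ _ il, seminormalE _ _ li,
  seminormalE _ _ jl, seminormalE _ _ lj, seminormalE_next _ _ _ ij, seminormalE_next _ _
    _ ji,
  seminormalE_next _ _ _ il, seminormalE_next _ _ _ li, seminormalE_next _ _ _ jl,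
  seminormalE_next _ _ _ lj).
rewrite !calc !content_eps (negbTE ij) (negbTE jl) (negbTE il) (negbTE ji) (negbTE lj)
  (negbTE li) !addr0.
move: (content _ i) (content _ j) (content _ l) => x y z.
move: (walk_vec _) (walk_vec _) (walk_vec _) (walk_vec _) (walk_vec _) (walk_vec _).
move=> E1 E2 E3 E4 E5 E6 d1 d2 d3; apply/rowP => q; rewrite !mxE; field.
by rewrite -[y - z]opprB -[x - y]opprB !oppr_eq0 d1 d2 d3.
Qed.

Lemma seminormal_repr_exists : exists rG : mx_representation k [set: 'S_r] N,
  forall a b : 'I_r, b = a.+1 :> nat -> rG (tperm a b) = seminormal a.
Proof.
apply: coxeter_repr; split; first exact: seminormal_sq; first exact: seminormal_braid.
exact: seminormal_comm.
Qed.

(** The images of the Jucys--Murphy elements $\sum_{b<a}(b\,a)$. *)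
Fixpoint jucys_murphy (a : nat) : 'M[k]_N :=
  if a is b.+1 then seminormal b *m jucys_murphy b *m seminormal b + seminormal b
  else 0.

Lemma alcove_eps0 i : alcove (eps i) -> i = ord0.
Proof.
move/alcoveP => [/(_ ord0 i (leq0n _))]; rewrite -[eps i]add0r !epsE !mxE eqxx.
by case: (eqVneq ord0 i) => // _ ? _; lia.
Qed.

Lemma jucys_murphyE u i v :
  walk_vec (u ++ i :: v) *m jucys_murphy (size u) =
  content (wt u) i *: walk_vec (u ++ i :: v).
Proof.
elim/last_ind: u i v => [|u h IHu] i v.
  case: (boolP (walk_to ([::] ++ i :: v))) => hw;
    last by rewrite walk_vec0 // mul0mx scaler0.
  have /and3P [_ /andP [_ /alcove_walk_start +] _] := hw.
  rewrite add0r => /alcove_eps0 ->.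
  by rewrite mulmx0 wt_nil /content mxE subrr scale0r.
rewrite cat_rcons; case: (boolP (walk_to (u ++ h :: i :: v))) => hw; last first.
  by rewrite walk_vec0 // mul0mx scaler0.
rewrite size_rcons /= mulmxDr !mulmxA wt_rcons content_eps.
case: (eqVneq i h) => [->|ih].
  by rewrite seminormal_same IHu -scalemxAl seminormal_same scalerDl scale1r.
have hi : h != i by rewrite eq_sym.
have d0 := alcove_content_inj (walk_to_alcove hw) ih.
rewrite !(mulmxDl, mulmx_scale_left, seminormalE _ _ ih, seminormalE _ _ hi, IHu) addr0.
move: (content _ i) (content _ h) d0 => y x d0.
have d0' : x - y != 0 by rewrite -opprB oppr_eq0.
move: (walk_vec _) (walk_vec _) => E F.
by apply/rowP => q; rewrite !mxE; field; rewrite d0 d0'.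
Qed.

Lemma first_difference (s t : seq letter) : size s = size t -> s != t ->
  exists u i j v v', [/\ s = u ++ i :: v, t = u ++ j :: v' & i != j].
Proof.
elim: s t => [|i s IHs] [|j t] //= [sz].
rewrite eqseq_cons negb_and; case: (eqVneq i j) => [<- /= st|ij _].
  have [u [i' [j' [v [v' [-> -> ne]]]]]] := IHs t sz st.
  by exists (i :: u), i', j', v, v'.
by exists [::], i, j, s, t.
Qed.

(** At the first difference of two walks the steps start from the same weight, and
    residues of different indices at a weight of the alcove are different. *)
Lemma jucys_murphy_separates s t : walk_to s -> walk_to t -> s != t ->
  exists a x y, [/\ (a < r)%N, x != y,
    walk_vec s *m jucys_murphy a = x *: walk_vec s &
    walk_vec t *m jucys_murphy a = y *: walk_vec t].
Proof.
move=> hs ht st; have /andP [/eqP ss _] := hs; have /andP [/eqP sz _] := ht.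
have [|u [i [j [v [v' [es et ij]]]]]] := first_difference _ st; first by rewrite ss.
exists (size u), (content (wt u) i), (content (wt u) j); split.
- by rewrite -ss es size_cat /=; lia.
- by rewrite -subr_eq0 alcove_content_inj //; apply: (@walk_to_alcove _ (i :: v));
  rewrite -es.
- by rewrite es jucys_murphyE.
- by rewrite et jucys_murphyE.
Qed.

Lemma jucys_murphy_diag w a : walk_to w -> (a < r)%N ->
  exists c, walk_vec w *m jucys_murphy a = c *: walk_vec w.
Proof.
move=> hw ar; have /andP [/eqP sw _] := hw.
have sa : size (take a w) = a by rewrite size_takel // sw ltnW.
exists (content (wt (take a w)) (nth ord0 w a)).
have := jucys_murphyE (take a w) (nth ord0 w a) (drop a.+1 w).
by rewrite -drop_nth ?sw // cat_take_drop sa.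
Qed.

Section Irreducible.

Variable rG : mx_representation k [set: 'S_r] N.
Hypothesis rGE : forall a b : 'I_r, b = a.+1 :> nat -> rG (tperm a b) = seminormal a.

Lemma module_seminormal (U : 'M[k]_N) (v : 'rV[k]_N) a : mxmodule rG U ->
  (a.+1 < r)%N -> (v <= U)%MS -> (v *m seminormal a <= U)%MS.
Proof.
move=> modU ar vU; rewrite -(@rGE (Ordinal (ltnW ar)) (Ordinal ar)) //.
by apply: (submx_trans (submxMr _ vU)); apply: (mxmoduleP modU); rewrite inE.
Qed.

Lemma module_jucys_murphy (U : 'M[k]_N) (v : 'rV[k]_N) a : mxmodule rG U ->
  (a < r)%N -> (v <= U)%MS -> (v *m jucys_murphy a <= U)%MS.
Proof.
move=> modU; elim: a v => [|a IHa] v ar vU /=; first by rewrite mulmx0 sub0mx.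
rewrite mulmxDr addmx_sub ?module_seminormal // !mulmxA.
by rewrite module_seminormal // IHa ?module_seminormal // ltnW.
Qed.

(** A vector of minimal support in a submodule is a multiple of a single basis
    vector, because the Jucys--Murphy elements tell distinct walks apart. *)
Lemma module_walk_vec (U : 'M[k]_N) : mxmodule rG U -> U != 0 ->
  exists2 w, walk_to w & (walk_vec w <= U)%MS.
Proof.
move=> modU /rowV0Pn [v vU v0].
have [m] := ubnP #|[set x | v 0 x != 0]|; elim: m v vU v0 => // m IHm v vU v0.
rewrite ltnS => le_m.
have [x vx] : exists x, v 0 x != 0.
  apply/existsP; apply: contraNT v0; rewrite negb_exists => /forallP h.
  by apply/eqP/rowP => x; rewrite mxE; apply/eqP/negPn/h.
case: (pickP [pred y | (y != x) && (v 0 y != 0)]) => [y /andP [yx vy]|only_x].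
  have [|a [cx [cy [ar cxy ex ey]]]] := jucys_murphy_separates (walk_to_of x)
    (walk_to_of y).
    by rewrite (inj_eq val_inj) (inj_eq (@enum_val_inj _ _)) eq_sym.
  have [c hc] := fin_all_exists (fun z => jucys_murphy_diag (walk_to_of z) ar).
  have eig z d : walk_vec (walk_of z) *m jucys_murphy a = d *: walk_vec
    (walk_of z) -> d = c z.
    rewrite hc => /eqP; rewrite -subr_eq0 -scalerBl scaler_eq0.
    by rewrite (negbTE (walk_vec_neq0 (walk_to_of z))) orbF subr_eq0 => /eqP.
  rewrite (eig _ _ ex) (eig _ _ ey) in cxy.
  have vE z : (v *m jucys_murphy a) 0 z = v 0 z * c z.
    rewrite {1}(row_sum_delta v) mulmx_suml summxE (bigD1 z) //= -scalemxAl.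
    rewrite -walk_vec_enum hc walk_vec_enum !mxE !eqxx mulr1 big1 ?addr0 // => q qz.
    by rewrite -scalemxAl -walk_vec_enum hc walk_vec_enum !mxE eqxx eq_sym
      (negbTE qz) !mulr0.
  (* The coordinate at x is removed and the one at y survives. *)
  pose v' := v *m jucys_murphy a - c x *: v.
  have v'E z : v' 0 z = v 0 z * (c z - c x) by rewrite mxE vE !mxE mulrBr [c x * _]mulrC.
  apply: (IHm v').
  - by rewrite addmx_sub ?module_jucys_murphy // -scaleNr scalemx_sub.
  - apply/eqP => /rowP /(_ y) /eqP; rewrite v'E mxE mulf_eq0 (negbTE vy) subr_eq0.
    by rewrite eq_sym (negbTE cxy).
  apply: leq_trans le_m; apply: proper_card; apply/properP; split.
    by apply/subsetP => z; rewrite !inE v'E mulf_eq0 negb_or => /andP [].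
  by exists x; rewrite !inE ?v'E ?subrr ?mulr0 ?eqxx.
exists (walk_of x); first exact: walk_to_of.
rewrite walk_vec_enum; have -> : delta_mx 0 x = (v 0 x)^-1 *: v.
  apply/rowP => y; rewrite !mxE eqxx /=; case: (eqVneq y x) => [->|yx];
    first by rewrite mulVf.
  by have /negbT := only_x y; rewrite /= yx negbK => /eqP ->; rewrite mulr0.
exact: scalemx_sub.
Qed.

End Irreducible.

End Seminormal.

End Alcove.

(** * Columns of a partition *)

Lemma card_interval r s h : (s + h <= r)%N -> #|[set a : 'I_r | (s <= a < s + h)%N]| = h.
Proof.
move=> le; have fr (i : 'I_h) : (s + i < r)%N by have := ltn_ord i; lia.
pose f (i : 'I_h) := Ordinal (fr i).
have f_inj : injective f by move=> i j [] e; apply: val_inj; apply: (addnI e).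
rewrite -[RHS]card_ord -(card_imset predT f_inj); apply: eq_card => a; rewrite !inE.
apply/idP/imsetP => [ha|[i _ ->]]; last by rewrite /=; have := ltn_ord i; lia.
have ih : (a - s < h)%N by lia.
by exists (Ordinal ih) => //; apply: val_inj; rewrite /=; lia.
Qed.

Definition place_column (hs : seq nat) r (q : 'I_r) : nat := reshape_index hs q.

Section Places.

Variables (hs : seq nat) (r : nat).
Hypothesis sum_hs : sumn hs = r.

Lemma place_columnE c (q : 'I_r) : (c < size hs)%N ->
  (place_column hs q == c) =
  (sumn (take c hs) <= q < sumn (take c hs) + nth 0%N hs c)%N.
Proof.
move=> cs; have qr : (q < sumn hs)%N by rewrite sum_hs.
apply/eqP/idP => [<-|/andP [h1 h2]].
  have := reshape_indexK hs q; have := reshape_offsetP qr.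
  by rewrite /place_column /flatten_index; lia.
have e : (q : nat) = flatten_index hs c (q - sumn (take c hs)).
  by rewrite /flatten_index; lia.
by rewrite /place_column e flatten_indexKl //; lia.
Qed.

Lemma place_column_lt (q : 'I_r) : (place_column hs q < size hs)%N.
Proof. by apply: reshape_indexP; rewrite sum_hs. Qed.

Lemma sumn_take_leq c : (c < size hs)%N ->
  (sumn (take c hs) + nth 0%N hs c <= r)%N.
Proof.
move=> cs; rewrite -sum_hs -{3}(cat_take_drop c.+1 hs) sumn_cat.
by rewrite (take_nth 0%N) // sumn_rcons leq_addr.
Qed.

Lemma card_col_class c : #|col_class (@place_column hs r) c| = nth 0%N hs c.
Proof.
case: (ltnP c (size hs)) => cs; last first.
  rewrite nth_default //; apply/eqP; rewrite cards_eq0; apply/eqP/setP => q.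
  by rewrite !inE; apply/negbTE; rewrite neq_ltn (leq_trans (place_column_lt q) cs).
rewrite -(@card_interval r (sumn (take c hs)) (nth 0%N hs c)).
  by apply: eq_card => q; rewrite !inE place_columnE.
exact: sumn_take_leq.
Qed.

End Places.

Section Walks.

Variables (p : nat) (n : nat).

Notation weight := 'rV[int]_n.+1.
Notation letter := 'I_n.+1.
Notation alcove := (@bottom_alcove p n).
Notation alcove_walk := (@alcove_walk p n).
Notation eps i := (delta_mx 0 i : weight).

Lemma wt_ge0 (w : seq letter) i : 0 <= wt w 0 i.
Proof. by rewrite wtE. Qed.

Lemma sum_wt (w : seq letter) : \sum_i wt w 0 i = (size w)%:Z.
Proof.
elim: w => [|j w IHw]; first by rewrite wt_nil big1 // => i _; rewrite mxE.
rewrite wt_cons addrC (eq_bigr (fun i => wt w 0 i + (i == j)%:Z)) => [|i _].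
  rewrite big_split /= IHw (bigD1 j) //= eqxx big1 => [|i /negbTE -> //].
  by rewrite addr0 [RHS]intS addrC.
exact: epsE.
Qed.

Lemma alcove_walk_prefix (w : seq letter) :
  (forall q, (q <= size w)%N -> alcove (wt (take q w))) -> alcove_walk 0 w.
Proof.
elim/last_ind: w => [|w i IHw] h; first by have := h 0%N isT; rewrite take0 wt_nil /= andbT.
rewrite alcove_walk_rcons add0r -wt_rcons IHw.
  by have := h _ (leqnn _); rewrite take_size.
move=> q qw; have := h q; rewrite size_rcons -cats1 takel_cat //; apply; exact: leqW.
Qed.

Definition column (h : nat) : seq letter := [seq inord j | j <- iota 0 h].

Lemma size_column h : size (column h) = h.
Proof. by rewrite size_map size_iota. Qed.

Lemma columnSr h : column h.+1 = rcons (column h) (inord h).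
Proof. by rewrite /column -map_rcons -cats1 -(iotaD 0 h 1) addn1. Qed.

Lemma wt_column h j : (h <= n.+1)%N -> wt (column h) 0 j = (j < h)%N%:Z.
Proof.
elim: h => [|h IHh] hn; first by rewrite /column wt_nil mxE.
rewrite columnSr wt_rcons epsE (IHh (ltnW hn)) -val_eqE /= inordK //.
by case: (ltnP j h.+1); case: (ltnP j h); case: eqP => /=; lia.
Qed.

Lemma take_column i h : (i <= h)%N -> take i (column h) = column i.
Proof. by move=> ih; rewrite -map_take take_iota (minn_idPl ih). Qed.

Section Columns.

Variable la : weight.
Hypotheses (la_ge0 : forall i, 0 <= la 0 i) (la_alcove : alcove la).

Notation heights := (conj_part (parts la)).

Lemma part_antitone (i j : letter) : (i <= j)%N -> (absz (la 0%R j) <= absz (la 0%R i))%N.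
Proof.
move=> ij; have /alcoveP [/(_ _ _ ij) + _] := la_alcove.
by have := la_ge0 i; have := la_ge0 j; lia.
Qed.

Lemma size_heights : size heights = absz (la 0%R ord0).
Proof.
rewrite size_map size_iota /parts -nth0 (nth_map ord0) ?size_enum_ord //.
by congr (absz (la 0%R _)); apply: val_inj; rewrite /= nth_enum_ord.
Qed.

(** Both sides say that the diagram has a box in row $j$ and column $c$. *)
Lemma lt_height (c : nat) (j : letter)
  : (j < nth 0%N heights c)%N = (c < absz (la 0%R j))%N.
Proof.
case: (ltnP c (size heights)) => hc; last first.
  rewrite nth_default //; move: hc; rewrite size_heights => hc.
  by have := @part_antitone ord0 j (leq0n _); lia.
rewrite (nth_map 0%N) ?size_iota; last by move: hc; rewrite size_map size_iota.
rewrite nth_iota ?add0n; last by move: hc; rewrite size_map size_iota.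
rewrite /parts count_map -sum1_count big_enum_cond /= sum1_card.
rewrite -[#|_|](@cardsE _ (fun i : letter => c < absz (la 0%R i))%N).
case: (leqP (absz (la 0%R j)) c) => cj.
  apply/negbTE; rewrite -leqNgt.
  apply: (@leq_trans #|[set i : letter | (i < j)%N]|).
    apply: subset_leq_card; apply/subsetP => i; rewrite !inE => ci.
    by rewrite ltnNge; apply/negP => /part_antitone; lia.
  rewrite -sum1dep_card -(big_ord_widen _ (fun=> 1%N)) ?sum1_card ?card_ord //.
  exact: ltnW.
apply: (@leq_trans #|[set i : letter | (i < j.+1)%N]|).
  rewrite -sum1dep_card -(big_ord_widen _ (fun=> 1%N)) ?sum1_card ?card_ord //.
apply: subset_leq_card; apply/subsetP => i; rewrite !inE ltnS => /part_antitone; lia.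
Qed.

Lemma height_le c : (nth 0%N heights c <= n.+1)%N.
Proof.
case: (ltnP c (size heights)) => hc; last by rewrite nth_default.
move: hc; rewrite size_map size_iota => hc.
rewrite (nth_map 0%N) ?size_iota //; apply: leq_trans (count_size _ _) _.
by rewrite size_map size_enum_ord.
Qed.

Lemma height_antitone c d : (c <= d)%N -> (nth 0%N heights d <= nth 0%N heights c)%N.
Proof.
move=> cd; rewrite leqNgt; apply/negP => lt.
have hn : (nth 0%N heights c < n.+1)%N by apply: leq_trans lt (height_le d).
have := lt_height d (Ordinal hn); rewrite lt => /esym lt'.
have := lt_height c (Ordinal hn); rewrite /= ltnn => /esym/negP; apply; lia.
Qed.

Lemma height_gt0 c : (c < size heights)%N -> (0 < nth 0%N heights c)%N.
Proof. by rewrite size_heights => h; rewrite (lt_height c ord0). Qed.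

Definition columns : seq (seq letter) := [seq column h | h <- heights].

(** The walk that fills the columns from left to right, each of them from top to
    bottom. *)
Definition column_word : seq letter := flatten columns.

Lemma wt_columns c j : wt (flatten (take c columns)) 0 j = (minn c (absz (la 0%R j)))%:Z.
Proof.
elim: c => [|c IHc]; first by rewrite take0 wt_nil mxE min0n.
case: (ltnP c (size columns)) => hc; last first.
  have e : (absz (la 0%R j) <= c)%N.
    apply: (leq_trans (@part_antitone ord0 j (leq0n _))).
    by rewrite -size_heights; move: hc; rewrite size_map.
  by rewrite take_oversize ?leqW // -(take_oversize hc) IHc; congr Posz; lia.
rewrite (take_nth [::]) // -cats1 flatten_cat /= cats0 wt_cat !mxE IHc.
rewrite (nth_map 0%N) -?(size_map column) // wt_column ?height_le // lt_height.
by congr Posz; lia.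
Qed.

Lemma shape_columns : shape columns = heights.
Proof.
rewrite /shape /columns -map_comp -[RHS]map_id; apply: eq_map => h.
exact: size_column.
Qed.

Lemma size_columns_prefix c : size (flatten (take c columns)) = sumn (take c heights).
Proof. by rewrite size_flatten /shape map_take -/(shape _) shape_columns. Qed.

Lemma size_column_word : size column_word = sumn heights.
Proof. by rewrite size_flatten shape_columns. Qed.

Lemma column_word_split c : (c < size heights)%N ->
  column_word = flatten (take c columns) ++ column (nth 0%N heights c) ++
    flatten (drop c.+1 columns).
Proof.
move=> hc; rewrite /column_word -{1}(cat_take_drop c columns) flatten_cat.
have hc' : (c < size columns)%N by rewrite size_map.
by rewrite (drop_nth [::] hc') [nth _ columns _](nth_map 0%N).
Qed.

Lemma take_column_word q : (q < sumn heights)%N ->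
  let c := reshape_index heights q in let i := reshape_offset heights q in
  [/\ (c < size heights)%N, (i < nth 0%N heights c)%N &
      take q column_word = flatten (take c columns) ++ column i].
Proof.
move=> qr c i; have ic : (i < nth 0%N heights c)%N by apply: reshape_offsetP.
have cs : (c < size heights)%N by apply: reshape_indexP.
split=> //; rewrite (column_word_split cs) -{1}(reshape_indexK heights q).
rewrite /flatten_index -/c -/i -size_columns_prefix takeD take_size_cat //.
by rewrite drop_size_cat // takel_cat ?size_column 1?ltnW // take_column // ltnW.
Qed.

Lemma wt_column_word : wt column_word = la.
Proof.
apply/rowP => j; rewrite /column_word -[columns](take_oversize (leqnn _)) wt_columns.
have := la_ge0 j; have := @part_antitone ord0 j (leq0n _).
by rewrite size_map size_heights; lia.
Qed.

Hypothesis np : (n.+1 < p)%N.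

(** A partially filled column makes the first and the last part differ by at most
    one when all its predecessors have full height, and otherwise by no more than
    they differ in $\lambda$. *)
Lemma column_word_walk : alcove_walk 0 column_word.
Proof.
apply: alcove_walk_prefix => q; rewrite leq_eqVlt => /orP [/eqP ->|].
  by rewrite take_size wt_column_word.
rewrite size_column_word => /take_column_word [cs ic ->].
move: (reshape_index _ _) (reshape_offset _ _) cs ic => c i cs ic.
have hn := height_le c; have i_n : (i <= n.+1)%N by lia.
have e j : wt (flatten (take c columns) ++ column i) 0 j =
    (minn c (absz (la 0%R j)))%:Z + (j < i)%N%:Z.
  by rewrite wt_cat mxE wt_columns wt_column.
apply/alcoveP; split=> [a b ab|]; rewrite ?e.
  by have := part_antitone ab; lia.
have [n0|n0] := posnP n; [by left|right].
have := height_gt0 cs; have /alcoveP [_ [?|]] := la_alcove; first lia.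
have := la_ge0 ord0; have := la_ge0 ord_max; have := lt_height c ord0.
by rewrite ?e size_heights in cs *; rewrite ?e /=; lia.
Qed.

End Columns.

Lemma size_walk (w w' : seq letter) : wt w = wt w' -> size w = size w'.
Proof. by move=> e; have := sum_wt w; rewrite e sum_wt => -[]. Qed.

(** An index cannot be equal to both $i$ and $j$, so every inequality for $\nu$ is
    implied by the same inequality for one of the two larger weights. *)
Lemma alcove_corner (nu : weight) i j :
  alcove (nu + eps i) -> alcove (nu + eps j) -> i != j -> alcove nu.
Proof.
move=> /alcoveP [d1 w1] /alcoveP [d2 w2] ij.
have ne a : a != i \/ a != j.
  by case: (eqVneq a i) => [->|_]; [right|left].
apply/alcoveP; split=> [a b ab|].
  by have := d1 a b ab; have := d2 a b ab; rewrite !epsE; case: (ne a) => /negbTE ->; lia.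
have [n0|n0] := posnP n; [by left|right].
case: w1 => [|w1]; first lia; case: w2 => [|w2]; first lia.
by move: w1 w2; rewrite !epsE; case: (ne ord_max) => /negbTE ->; lia.
Qed.

Hypothesis np : (n.+1 < p)%N.

(** Two walks with the same end whose last steps $i\ne j$ differ are linked
    through walks ending with $ij$ and with $ji$: the alcove contains
    $\lambda-\epsilon_i-\epsilon_j$, and the column word of that weight is a walk. *)
Lemma walks_connected (P : seq letter -> Prop) s t :
    (forall u i j v, i != j -> alcove_walk 0 (u ++ i :: j :: v) ->
       alcove_walk 0 (u ++ j :: i :: v) -> P (u ++ i :: j :: v) ->
       P (u ++ j :: i :: v)) ->
  alcove_walk 0 s -> alcove_walk 0 t -> wt s = wt t -> P s -> P t.
Proof.
have [m] := ubnP (size s); elim: m s t P => // m IHm s t P.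
rewrite ltnS => sm Pswap; have := size_walk (w := s) (w' := t).
case/lastP: s sm => [|s i] sm; case/lastP: t => [|t j] // sz.
- by move=> _ _ /sz; rewrite size_rcons.
- by move=> _ _ /sz; rewrite size_rcons.
rewrite size_rcons in sm.
rewrite !alcove_walk_rcons !add0r !wt_rcons => /andP [ws as_] /andP [wt_ at_] est Ps.
have same (x y : seq letter) l : (size x < m)%N -> alcove_walk 0 x -> alcove_walk 0 y ->
    alcove (wt x + eps l) -> wt x = wt y -> P (rcons x l) -> P (rcons y l).
  move=> xm wx wy al exy Px.
  apply: (IHm x y (fun z => wt z = wt x -> P (rcons z l))) => // u a b v ab w1 w2 Pu ew.
  have e2 : wt (u ++ [:: a, b & v]) = wt x.
    by rewrite -ew !wt_cat !wt_cons (addrCA (eps a)).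
  rewrite rcons_cat /=; apply: Pswap => //.
  - by rewrite -!rcons_cons -rcons_cat alcove_walk_rcons w1 add0r e2.
  - by rewrite -!rcons_cons -rcons_cat alcove_walk_rcons w2 add0r ew.
  by rewrite -!rcons_cons -rcons_cat; apply: Pu.
have sst : size s = size t.
  by apply: succn_inj; rewrite -(size_rcons s i) -(size_rcons t j); apply: sz;
    rewrite !wt_rcons.
move: est at_; case: (eqVneq i j) => [<- est _|ij est at_].
  by apply: same Ps => //; apply: (addIr (eps i)).
(* The weight before the last two steps, which both walks may be made to visit. *)
pose nu : weight := wt s - eps j.
have e_t : wt t - eps i = nu.
  by rewrite /nu; apply: (addIr (eps j)); rewrite subrK addrAC -est addrK.
have ss : wt s = nu + eps j by rewrite subrK.
have st : wt t = nu + eps i by rewrite -e_t subrK.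
have alc_s : alcove (nu + eps j) by have := alcove_walk_end ws; rewrite add0r ss.
have alc_t : alcove (nu + eps i) by have := alcove_walk_end wt_; rewrite add0r st.
have nu_ge0 l : 0 <= nu 0 l.
  have := wt_ge0 s l; have := wt_ge0 t l; rewrite ss st !epsE.
  by case: (eqVneq l i) => [->|_]; rewrite ?(negbTE ij) => *; lia.
have nu_alcove : alcove nu by apply: alcove_corner alc_t alc_s ij.
pose w := column_word nu.
have ww : alcove_walk 0 w by apply: column_word_walk.
have ew : wt w = nu by apply: wt_column_word.
have wi : alcove_walk 0 (rcons w i) by rewrite alcove_walk_rcons ww add0r ew.
have wj : alcove_walk 0 (rcons w j) by rewrite alcove_walk_rcons ww add0r ew.
have ewi : wt (rcons w i) = wt t by rewrite wt_rcons ew -st.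
have ewj : wt (rcons w j) = wt s by rewrite wt_rcons ew -ss.
have cat2 a b : w ++ [:: a; b] = rcons (rcons w a) b by rewrite -!cats1 -catA.
apply: (same (rcons w i)) => //; [by rewrite (size_walk ewi) -sst|by rewrite ewi|].
rewrite -cat2; apply: Pswap; rewrite ?cat2 1?eq_sym //.
- by rewrite alcove_walk_rcons wj add0r ewj.
- by rewrite alcove_walk_rcons wi add0r ewi -est.
by apply: (same s).
Qed.

End Walks.

(** * Irreducibility and the Garnir vector of the seminormal representation *)

Section SeminormalModule.

Variables (k : fieldType) (p : nat) (n : nat).
Hypotheses (hp : p \in [pchar k]) (np : (n.+1 < p)%N).

Notation weight := 'rV[int]_n.+1.
Notation letter := 'I_n.+1.
Notation alcove := (@bottom_alcove p n).
Notation alcove_walk := (@alcove_walk p n).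
Notation eps i := (delta_mx 0 i : weight).
Notation cont := (@content k n).

Variables (r : nat) (la : weight).
Hypotheses (la_ge0 : forall i, 0 <= la 0 i) (la_alcove : alcove la)
  (la_sum : \sum_i la 0 i = r%:Z).

Notation heights := (conj_part (parts la)).
Notation N := #|walks p r la|.
Notation walk := (walk_to p r la).
Notation walk_vec := (@walk_vec k p n r la).
Notation seminormal := (@seminormal k p n r la).

Lemma column_word_walk_to : walk (column_word la).
Proof.
rewrite /walk_to column_word_walk // (wt_column_word la_ge0 la_alcove) eqxx andbT /=.
have := sum_wt (column_word la); rewrite (wt_column_word la_ge0 la_alcove) la_sum.
by rewrite andbT => -[->].
Qed.

Variable rG : mx_representation k [set: 'S_r] N.
Hypothesis rGE : forall a b : 'I_r, b = a.+1 :> nat -> rG (tperm a b) = seminormal a.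

(** A nonzero submodule contains the vector of a walk. It then contains those of all
    walks: the coefficient $1-d^{-1}$ of the exchanged walk is nonzero, as $d=1$
    would give two equal residues after the first of the two steps. *)
Lemma seminormal_irreducible : mx_irreducible rG.
Proof.
split; first exact: mxmodule1.
  have [x ex] := walk_to_enum column_word_walk_to.
  apply/eqP => /(congr1 (mulmx (walk_vec (walk_of x)))) /eqP.
  by rewrite mulmx1 mulmx0 (negbTE (walk_vec_neq0 k (walk_to_of x))).
move=> U modU _ U0; have [w ww wU] := module_walk_vec hp np rGE modU U0.
have [/andP [/eqP sw /andP [aw /eqP ew]]] := ww.
apply/row_subP => x; rewrite rowE mulmx1 -walk_vec_enum.
have /and3P [_ ax /eqP ex] := walk_to_of x.
apply: (walks_connected np (P := fun w => (walk_vec w <= U)%MS) _ aw ax _ wU); last first.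
  by rewrite ex.
move=> u i j v ij w1 w2 uU.
case: (boolP (walk (u ++ i :: j :: v))) => hw; last first.
  rewrite walk_vec0 ?sub0mx //; apply: contra hw.
  rewrite /walk_to w1 w2 !size_cat /= !wt_cat !wt_cons.
  by rewrite (addrCA (eps i)).
have ar : ((size u).+1 < r)%N.
  by have /andP [/eqP + _] := hw; rewrite size_cat /= => <-; rewrite !addnS !ltnS leq_addr.
have := module_seminormal rGE modU ar uU; rewrite seminormalE //.
set d := _ - _; move=> h.
have d1 : 1 - d^-1 != 0.
  have ai : alcove (wt u + eps i).
    by rewrite -wt_rcons; apply: (@walk_to_alcove p n r la _ (j :: v)); rewrite cat_rcons.
  have ji : j != i by rewrite eq_sym.
  apply: contraNneq (alcove_content_inj hp np ai ji) => /eqP.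
  rewrite subr_eq0 eq_sym invr_eq1 => /eqP e; rewrite !content_eps eqxx (negbTE ji) addr0.
  by rewrite opprD addrA [X in X - _]e subrr.
have := addmx_sub h (scalemx_sub (- d^-1) uU).
rewrite addrAC scaleNr addrN add0r => /(scalemx_sub (1 - d^-1)^-1).
by rewrite scalerA mulVf // scale1r.
Qed.

(** Two rows of equal length are filled one below the other: the residues differ by
    $-1$, and the exchanged word is not a walk as it violates dominance. *)
Lemma column_alternating_adjacent u h v i :
    (h <= n.+1)%N -> (forall j : letter, (j < h)%N -> wt u 0 j = wt u 0 ord0) ->
    (i.+1 < h)%N ->
  walk_vec (u ++ column n h ++ v) *m seminormal (size u + i) =
  - walk_vec (u ++ column n h ++ v).
Proof.
move=> hn flat ih.
have [t et] : exists t, u ++ column n h ++ v =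
    (u ++ column n i) ++ inord i :: inord i.+1 :: t.
  exists ([seq inord j | j <- iota i.+2 (h - i.+2)] ++ v).
  have e : iota 0 h = iota 0 i ++ [:: i, i.+1 & iota i.+2 (h - i.+2)].
    by rewrite -{1}(subnKC ih) iotaD -{1}addn2 iotaD -catA.
  by rewrite /column e map_cat -!catA.
pose a : letter := inord i; pose b : letter := inord i.+1.
have va : a = i :> nat by rewrite inordK //; lia.
have vb : b = i.+1 :> nat by rewrite inordK //; lia.
have ab : a != b by rewrite -val_eqE /= va vb; lia.
have su : size (u ++ column n i) = (size u + i)%N by rewrite size_cat size_column.
have wE (j : letter) : (j < h)%N -> wt (u ++ column n i) 0 j = wt u 0 ord0 + (j < i)%N%:Z.
  by move=> jh; rewrite wt_cat mxE flat // wt_column //; lia.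
have ea : wt (u ++ column n i) 0 a = wt u 0 ord0 by rewrite wE va ?ltnn ?addr0 //; lia.
have eb : wt (u ++ column n i) 0 b = wt u 0 ord0.
  by rewrite wE vb; [rewrite ltnNge leqW ?addr0 //|lia].
have d1 : cont (wt (u ++ column n i)) b - cont (wt (u ++ column n i)) a = -1.
  rewrite /content ea eb va vb -intrB opprD addrACA subrr add0r.
  by have -> : - i.+1%:Z - - i%:Z = -1 by lia.
rewrite et -su seminormalE // d1 invrN1 scaleN1r.
rewrite [walk_vec (_ ++ b :: _)]walk_vec0 ?scaler0 ?addr0 //.
rewrite -[_ ++ _ :: _]cat_rcons; apply/negP => /walk_to_alcove /alcoveP [/(_ a b) + _].
rewrite wt_rcons !epsE ea eb eqxx (negbTE ab) va vb => /(_ (leqnSn _)); lia.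
Qed.

Lemma alternating_interval (v : 'rV[k]_N) s h :
    (forall i, (i.+1 < h)%N -> (s + i.+1 < r)%N -> v *m seminormal (s + i) = - v) ->
  forall a b : 'I_r, (s <= a)%N -> (a < b)%N -> (b < s + h)%N ->
  v *m rG (tperm a b) = - v.
Proof.
move=> alt a b sa ab bh; have [d ed] : {d | (b = a + d.+1 :> nat)%N}
  by exists (b - a.+1)%N; lia.
elim: d b ed {ab} bh => [|d IHd] b eb bh.
  rewrite rGE ?eb ?addn1 //; have -> : (a : nat) = (s + (a - s))%N by lia.
  by apply: alt; have := ltn_ord b; lia.
have yr := ltn_ord b; have zr : (a + d.+1 < r)%N by lia.
pose z := Ordinal zr.
have zb : v *m rG (tperm z b) = - v.
  rewrite (@rGE z b) /=; last lia; have -> : (a + d.+1)%N = (s + (a + d.+1 - s))%N by lia.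
  by apply: alt; lia.
have -> : tperm a b = (tperm z b * tperm a z * tperm z b)%g.
  by rewrite -{1}(tpermV z b) -mulgA -conjgE tpermJ tpermL tpermD //;
    rewrite -val_eqE /=; lia.
rewrite !repr_mxM ?inE // !mulmxA zb !mulNmx (IHd z) //=; last lia.
by rewrite mulNmx opprK zb.
Qed.

(** Induction on the height. Let $y$ be the last place of the column and $s$ the
    transposition of $y$ and $x$. For the other places $a$ one has
    $(a\,x)=(a\,y)s(a\,y)$, and $w$ alternates under $(a\,y)$. By the seminormal
    formula $ws$ is a combination of $w$ and of the word $w'$ in which the letter of
    the next column has moved before the last letter of this one, and $w'$ satisfies
    the relation of the column of height one less. The coefficients match because
    the difference of the residues is the height. *)
Lemma column_exchange h u v (x : 'I_r) :
    (0 < h <= n.+1)%N -> (forall j : letter, (j < h)%N -> wt u 0 j = wt u 0 ord0) ->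
    x = (size u + h)%N :> nat ->
  let w := u ++ column n h ++ ord0 :: v in
  walk_vec w = \sum_(a : 'I_r | (size u <= a < x)%N) walk_vec w *m rG (tperm a x).
Proof.
elim: h v x => // h IHh v x /andP [_ hn] flat ex w.
have xr := ltn_ord x; have yr : (size u + h < r)%N by lia.
pose y := Ordinal yr; have yx : x = y.+1 :> nat by rewrite /= ex; lia.
rewrite (bigD1 y) /=; last lia; rewrite rGE //.
pose hh : letter := inord h; have vh : hh = h :> nat by rewrite inordK.
have ew : w = (u ++ column n h) ++ hh :: ord0 :: v.
  by rewrite /w columnSr -cats1 -!catA.
have sw : size (u ++ column n h) = y by rewrite size_cat size_column.
case: (posnP h) => [h0|h0].
  rewrite {1 2}ew -sw; have -> : hh = ord0 by apply: val_inj; rewrite /= vh.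
  rewrite seminormal_same big1 ?addr0 // => a; rewrite -val_eqE /=; lia.
pose w' := u ++ column n h ++ ord0 :: hh :: v.
have alt (z : seq letter) (a : 'I_r) : (size u <= a < y)%N ->
    walk_vec (u ++ column n h.+1 ++ z) *m rG (tperm a y) =
    - walk_vec (u ++ column n h.+1 ++ z).
  move=> /andP [sa ay]; apply: (@alternating_interval _ (size u) h.+1) => //;
    last by rewrite /=; lia.
  by move=> i ih _; apply: column_alternating_adjacent.
have flat' (j : letter) : (j < h)%N -> wt u 0 j = wt u 0 ord0.
  by move=> jh; apply: flat; apply: ltnW.
have := IHh (hh :: v) y; rewrite h0 /= => /(_ (ltnW hn) flat' erefl).
rewrite -/w' => ew'.
have dE : cont (wt (u ++ column n h)) ord0 - cont (wt (u ++ column n h)) hh = h.+1%:R.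
  rewrite /content !wt_cat !mxE !wt_column ?(ltnW hn) // (flat hh) ?vh // h0 ltnn -intrB.
  have -> : wt u 0 ord0 + true%:Z - (ord0 : letter)%:Z -
      (wt u 0 ord0 + false%:Z - h%:Z) = h.+1%:Z by rewrite /=; lia.
  by rewrite -pmulrn.
have d0 : h.+1%:R != 0 :> k by apply: (natr_neq0_small hp); lia.
have h0x : hh != ord0 by rewrite -val_eqE /= vh; lia.
have Sw : walk_vec w *m seminormal y = h.+1%:R^-1 *: walk_vec w +
  (1 - h.+1%:R^-1) *: walk_vec w'.
  by rewrite ew -sw seminormalE // dE /w' -!catA.
rewrite Sw (eq_bigr (fun a : 'I_r => h.+1%:R^-1 *: walk_vec w -
   (1 - h.+1%:R^-1) *: (walk_vec w' *m rG (tperm a y)))); last first.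
  move=> a ha; have ay : (size u <= a < y)%N.
    by move: ha; rewrite -val_eqE /= => ?; lia.
  (* Conjugating by (a y) leaves only the exchange of the neighbours y and x. *)
  have -> : tperm a x = (tperm a y * tperm y x * tperm a y)%g.
    rewrite -{1}(tpermV a y) -mulgA -conjgE tpermJ tpermR tpermD //; rewrite -val_eqE /=;
      lia.
  rewrite !repr_mxM ?inE // !mulmxA /w alt // -/w mulNmx (rGE yx) Sw.
  rewrite mulNmx mulmxDl -!scalemxAl /w alt // -/w opprD scalerN opprK.
  by [].
rewrite sumrB -!scaler_sumr.
have card_rest : #|[pred a : 'I_r | (size u <= a < x)%N && (a != y)]| = h.
  rewrite -[RHS](@card_interval r (size u) h); last lia.
  by apply: eq_card => a; rewrite !inE -val_eqE /=; lia.
rewrite sumr_const card_rest.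
have -> : \sum_(a < r | (size u <= a < x)%N && (a != y))
    walk_vec w' *m rG (tperm a y) = walk_vec w'.
  rewrite [RHS]ew'; apply: eq_bigl => a; rewrite -val_eqE /=; lia.
rewrite addrACA subrr addr0 -scalerDr -mulrS -scaler_nat scalerA mulVf // scale1r.
by [].
Qed.

Lemma sum_heights : sumn heights = r.
Proof.
by have /andP [/eqP <- _] := column_word_walk_to; rewrite size_column_word.
Qed.

Lemma column_word_garnir :
  garnir (@place_column heights r) (fun s w => w *m rG s) (walk_vec (column_word la)).
Proof.
have sh := sum_heights; have hn := height_le la.
have flat c (j : letter) : (j < nth 0%N heights c)%N ->
    wt (flatten (take c (columns la))) 0 j = wt (flatten (take c (columns la))) 0 ord0.
  move=> jh; rewrite !(wt_columns la_ge0 la_alcove).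
  have := lt_height la_ge0 la_alcove c j; have := lt_height la_ge0 la_alcove c ord0.
  by rewrite jh (leq_ltn_trans (leq0n j) jh) => /esym h1 /esym h2; congr Posz; lia.
apply: (garnir_of_neighbours (repr_right_action rG)).
  move=> a b; wlog ab : a b / (a < b)%N => [H ne e|_ e].
    have : (a < b)%N || (b < a)%N by rewrite -neq_ltn.
    by case/orP => lt; [|rewrite tpermC]; apply: H => //; rewrite eq_sym.
  have cs := place_column_lt sh a; set c := place_column heights a in e cs.
  have /andP [a1 _] : (sumn (take c heights) <= a < sumn
    (take c heights) + nth 0%N heights c)%N.
    by rewrite -(place_columnE sh) // eqxx.
  have /andP [_ b1] : (sumn (take c heights) <= b < sumn
    (take c heights) + nth 0%N heights c)%N.
    by rewrite -(place_columnE sh) // e eqxx.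
  apply: (@alternating_interval _ (sumn (take c heights)) (nth 0%N heights c)) => // i ih _.
  rewrite (column_word_split cs) -size_columns_prefix.
  by apply: column_alternating_adjacent => //; apply: flat.
move=> x c ex.
have cs1 : (c.+1 < size heights)%N by rewrite -ex place_column_lt.
have cs : (c < size heights)%N by apply: ltnW.
have h1 := height_gt0 la_ge0 la_alcove cs1.
have le := sumn_take_leq sh cs1.
have st : sumn (take c.+1 heights) = (sumn (take c heights) + nth 0%N heights c)%N.
  by rewrite (take_nth 0%N) // sumn_rcons.
have xr : (sumn (take c heights) + nth 0%N heights c < r)%N by rewrite -st; lia.
exists (Ordinal xr); first by apply/eqP; rewrite (place_columnE sh) //= -st; lia.
have [v ev] : exists v, flatten (drop c.+1 (columns la)) = ord0 :: v.
  have cs1' : (c.+1 < size (columns la))%N by rewrite size_map.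
  rewrite (drop_nth [::] cs1') [nth _ (columns la) _](nth_map 0%N) //.
  case: (nth 0%N heights c.+1) h1 => // h _; rewrite /column /=.
  have -> : inord 0 = ord0 :> letter by apply: val_inj; rewrite /= inordK.
  by eexists.
have hc : (0 < nth 0%N heights c <= n.+1)%N.
  by rewrite hn andbT; apply: (height_gt0 la_ge0 la_alcove cs).
have := @column_exchange _ (flatten (take c (columns la))) v (Ordinal xr) hc (flat c).
rewrite /= size_columns_prefix -ev -(column_word_split cs) => /(_ erefl) {1}->.
by apply: eq_bigl => a; rewrite inE (place_columnE sh).
Qed.

End SeminormalModule.

(** * The highest weight tensor *)

Lemma place_word_inj r (s : 'S_r) : injective (@place_word r s).
Proof.
move=> u v /(congr1 (@place_word r s^-1)) e; apply: eq_from_tnth => j.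
by have := congr1 (fun w : word r => tnth w j) e; rewrite !tnth_mktuple permKV.
Qed.

Lemma place_right_action (k : fieldType) r : right_action (@place_act k r).
Proof.
split=> [s|x|s t x]; first exact: linearP.
  by apply/ffunP => w; rewrite ffunE; congr (x _); apply: eq_from_tnth => i;
    rewrite tnth_mktuple perm1.
apply/ffunP => w; rewrite !ffunE; congr (x _); apply: eq_from_tnth => i.
by rewrite !tnth_mktuple permM.
Qed.

Section AltCoef.

Variable k : fieldType.

Lemma alt_coefE (s : seq nat) h : size s = h ->
  alt_coef k s = \det (\matrix_(i < h, j < h) (nth 0%N s i == j)%:R).
Proof. by move<-. Qed.

Lemma alt_coef_swap (s t : seq nat) h (a b : 'I_h) : size s = h -> size t = h ->
    a != b -> (forall i : 'I_h, nth 0%N t i = nth 0%N s (tperm a b i)) ->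
  alt_coef k t = - alt_coef k s.
Proof.
move=> es et ab e; rewrite (alt_coefE es) (alt_coefE et).
set M := \matrix_(i, j) _; set M' := (X in - \det X).
have -> : M = perm_mx (tperm a b) *m M'.
  by rewrite -row_permE; apply/matrixP => i j; rewrite !mxE e.
by rewrite det_mulmx det_perm odd_tperm ab expr1 mulN1r.
Qed.

Lemma alt_coef_large (s : seq nat) i :
  (i < size s)%N -> (size s <= nth 0%N s i)%N -> alt_coef k s = 0.
Proof.
move=> si le; rewrite /alt_coef (expand_det_row _ (Ordinal si)) big1 // => j _.
by rewrite mxE /= gtn_eqF ?mul0r // (leq_trans (ltn_ord j)).
Qed.

Lemma alt_coef_iota h : alt_coef k (iota 0 h) = 1.
Proof.
rewrite (alt_coefE (size_iota 0 h)) -[RHS](det1 _ h); congr (\det _).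
by apply/matrixP => i j; rewrite !mxE nth_iota.
Qed.

End AltCoef.

(** The exchange relations for a tensor that is alternating in the places of
    each column and whose coordinates vanish on words with a letter at least as
    large as the height of its column: $h+1$ letters smaller than $h$ cannot be
    pairwise distinct, so every term either vanishes or cancels. *)
Lemma garnir_of_bounded (k : fieldType) r (col : 'I_r -> nat) (ht : nat -> nat)
    (z : tensorsp k r) :
    2%:R != 0 :> k -> (forall c, #|col_class col c| = ht c) ->
    (forall c d, (c <= d)%N -> (ht d <= ht c)%N) ->
    (forall a b, a != b -> col a = col b -> place_act (tperm a b) z = - z) ->
    (forall (w : word r) q, (ht (col q) <= tnth w q)%N -> z w = 0) ->
  garnir col (@place_act k r) z.
Proof.
move=> k2 card_col ht_anti alt large; split=> // x c cx.
apply/ffunP => w; rewrite sum_ffunE.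
have altE (u : word r) a b : a != b -> col a = col b ->
    z (place_word (tperm a b) u) = - z u.
  by move=> ab cab; have := congr1 (fun f : tensorsp k r => f u) (alt a b ab cab);
    rewrite !ffunE.
have rep (u : word r) a b : a != b -> col a = col b -> tnth u a = tnth u b -> z u = 0.
  move=> ab cab e; have := altE u a b ab cab.
  have -> : place_word (tperm a b) u = u.
    by apply: eq_from_tnth => i; rewrite tnth_mktuple; case: tpermP => [->|->|].
  by move/eqP; rewrite -addr_eq0 -mulr2n -mulr_natl mulf_eq0 (negbTE k2) => /eqP.
have nx a : a \in col_class col c -> a != x.
  by rewrite inE => /eqP ca; apply: contraTneq cx => <-; rewrite ca ltnn.
have tw s (u : word r) q : tnth (place_word s u) q = tnth u (s q) by rewrite tnth_mktuple.
under eq_bigr => a _ do rewrite ffunE.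
have hx : (ht (col x) <= ht c)%N by apply: ht_anti; apply: ltnW.
case: (boolP [exists y in col_class col c, ht c <= tnth w y]%N) =>
  [/exists_inP [y yc wy]|small].
  have cy : col y = c by apply/eqP; rewrite inE in yc.
  rewrite (large w y) ?cy // big1 // => a ac.
  case: (eqVneq a y) => [->|ay].
    by rewrite (large _ x) // tw tpermR (leq_trans hx).
  by rewrite (large _ y) // tw tpermD ?cy // eq_sym nx.
have {}small y : y \in col_class col c -> (tnth w y < ht c)%N.
  by move=> yc; rewrite ltnNge; apply: contra small => le; apply/exists_inP; exists y.
case: (leqP (ht c) (tnth w x)) => wx.
  rewrite (large w x) ?(leq_trans hx) // big1 // => a ac.
  by rewrite (large _ a) // tw tpermL; move: ac; rewrite inE => /eqP ->.
have /dinjectivePn [y1 y1D [y2 /andP /= [y21 y2D] ey]] :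
    ~~ dinjectiveb (tnth w) (x |: col_class col c).
  apply/negP => /dinjectiveP inj.
  have : (#|x |: col_class col c| <= #|[set l : 'I_r | (l < ht c)%N]|)%N.
    rewrite -(card_in_imset inj); apply: subset_leq_card; apply/subsetP => l.
    by case/imsetP => q; rewrite !inE => /orP [/eqP ->|qc] -> //; apply: small; rewrite inE.
  rewrite cardsU1 card_col (_ : x \notin _); last by apply/negP => /nx; rewrite eqxx.
  rewrite leqNgt ltnS -sum1dep_card.
  have [le|lt] := leqP (ht c) r; last first.
    by have := max_card (mem (col_class col c)); rewrite card_col card_ord leqNgt lt.
  by rewrite -(big_ord_widen _ (fun=> 1%N)) // sum1_card card_ord leqnn.
(* If the letter at x occurs at y, the transposition of y and x fixes w, and all
   the other terms have this letter twice in column c. *)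
have meet y : y \in col_class col c -> tnth w y = tnth w x ->
    z w = \sum_(a in col_class col c) z (place_word (tperm a x) w).
  move=> yc e; rewrite (bigD1 y) //= big1 ?addr0.
    congr (z _); apply: eq_from_tnth => i; rewrite tw.
    by case: tpermP => [->|->|].
  move=> a /andP [ac ay]; apply: (rep _ a y ay).
    by move: ac yc; rewrite !inE => /eqP -> /eqP ->.
  by rewrite !tw tpermL tpermD ?e // eq_sym nx.
rewrite !inE in y1D y2D.
case: (eqVneq y1 x) y1D => [e1 _|y1x /= y1c].
  case: (eqVneq y2 x) y2D => [e2 _|_ /= y2c]; first by rewrite e1 e2 eqxx in y21.
  by apply: (meet y2); rewrite ?inE // -ey e1.
case: (eqVneq y2 x) y2D => [e2 _|y2x /= y2c].
  by apply: (meet y1); rewrite ?inE // ey e2.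
have c12 : col y1 = col y2 by rewrite (eqP y1c) (eqP y2c).
have y12 : y1 != y2 by rewrite eq_sym.
rewrite (rep w y1 y2) // (bigD1 y1) ?inE //= (bigD1 y2) ?inE ?y2c //=.
rewrite addrA big1 ?addr0 => [|a /andP [/andP [ac ay1] ay2]].
  have -> : place_word (tperm y2 x) w =
      place_word (tperm y1 y2) (place_word (tperm y1 x) w).
    apply: eq_from_tnth => q; rewrite !tw.
    case: (eqVneq q y1) => [->|q1]; first by rewrite tpermL !tpermD 1?eq_sym.
    case: (eqVneq q y2) => [->|q2]; first by rewrite tpermL tpermR tpermL.
    case: (eqVneq q x) => [->|qx]; first by rewrite tpermR (tpermD y1x y2x) tpermR ey.
    by rewrite !tpermD // eq_sym.
  by rewrite (altE _ y1 y2) // subrr.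
by rewrite (rep _ y1 y2) // !tw !tpermD // 1?eq_sym // nx.
Qed.

Section HighestWeight.

Variables (k : fieldType) (r : nat) (la : seq nat).
Notation hs := (conj_part la).
Hypotheses (sum_hs : sumn hs = r)
  (hs_anti : forall c d, (c <= d)%N -> (nth 0%N hs d <= nth 0%N hs c)%N).

Definition letters_at (w : word r) (c : nat) : seq nat :=
  nth [::] (reshape hs [seq val i | i <- w]) c.

Lemma nth_letters_at (w : word r) (c i : nat) (q : 'I_r) :
    (i < nth 0%N hs c)%N -> (q : nat) = (sumn (take c hs) + i)%N ->
  nth 0%N (letters_at w c) i = tnth w q.
Proof.
move=> ic eq; rewrite /letters_at nth_reshape nth_take // nth_drop -eq.
by rewrite (nth_map q) ?size_tuple // -tnth_nth.
Qed.

Lemma size_letters_at (w : word r) c : (c < size hs)%N ->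
  size (letters_at w c) = nth 0%N hs c.
Proof.
move=> cs; rewrite /letters_at nth_reshape size_takel // size_drop size_map size_tuple.
by have := sumn_take_leq sum_hs cs; lia.
Qed.

Lemma hw_tensorE (w : word r) :
  hw_tensor k r la w = \prod_(c < size hs) alt_coef k (letters_at w c).
Proof.
by rewrite ffunE (big_nth [::]) size_reshape big_mkord.
Qed.

Lemma place_offset (q : 'I_r) : exists2 i : nat,
  (i < nth 0%N hs (place_column hs q))%N &
  (q : nat) = (sumn (take (place_column hs q) hs) + i)%N.
Proof.
have := place_columnE sum_hs q (place_column_lt sum_hs q).
rewrite eqxx => /esym/andP [h1 h2].
by exists (q - sumn (take (place_column hs q) hs))%N; lia.
Qed.

Lemma hw_tensor_large (w : word r) q :
  (nth 0%N hs (place_column hs q) <= tnth w q)%N -> hw_tensor k r la w = 0.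
Proof.
move=> le; have [i ic eq] := place_offset q; have cs := place_column_lt sum_hs q.
rewrite hw_tensorE (bigD1 (Ordinal cs)) //= (@alt_coef_large _ _ i) ?mul0r //.
  by rewrite size_letters_at.
by rewrite size_letters_at // (nth_letters_at _ ic eq).
Qed.

Lemma hw_tensor_alternating (a b : 'I_r) : a != b ->
    place_column hs a = place_column hs b ->
  place_act (tperm a b) (hw_tensor k r la) = - hw_tensor k r la.
Proof.
move=> ab cab; apply/ffunP => w; rewrite [LHS]ffunE [RHS]ffunE !hw_tensorE.
set c := place_column hs a; have cs : (c < size hs)%N := place_column_lt sum_hs a.
have place d i : (d < size hs)%N -> (i < nth 0%N hs d)%N ->
    exists2 q : 'I_r, q = (sumn (take d hs) + i)%N :> nat & place_column hs q = d.
  move=> ds id; have qr : (sumn (take d hs) + i < r)%N.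
    by have := sumn_take_leq sum_hs ds; lia.
  exists (Ordinal qr) => //; apply/eqP; rewrite (place_columnE sum_hs) //=; lia.
rewrite (bigD1 (Ordinal cs)) //= [in RHS](bigD1 (Ordinal cs)) //= -mulNr.
have [ia ia_lt ea] := place_offset a; have [ib ib_lt eb] := place_offset b.
rewrite -cab -/c in ia_lt ea ib_lt eb.
congr (_ * _).
  apply: (@alt_coef_swap _ _ _ _ (Ordinal ia_lt) (Ordinal ib_lt));
    rewrite ?size_letters_at //.
    by apply: contra ab => /eqP [e]; apply/eqP/val_inj; rewrite /= ea eb e.
  move=> i; have [q eq _] := place c i cs (ltn_ord i).
  rewrite (nth_letters_at _ (ltn_ord i) eq) tnth_mktuple.
  apply/esym/nth_letters_at; first exact: ltn_ord.
  case: tpermP => [e|e|/eqP n1 /eqP n2].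
  - by have -> : q = a; [apply: val_inj; rewrite /= eq e ea|rewrite tpermL eb].
  - by have -> : q = b; [apply: val_inj; rewrite /= eq e eb|rewrite tpermR ea].
  rewrite tpermD //.
    apply: contra n1 => /eqP e; apply/eqP/val_inj; apply: (@addnI (sumn (take c hs))).
    by rewrite -eq -e ea.
  apply: contra n2 => /eqP e; apply/eqP/val_inj; apply: (@addnI (sumn (take c hs))).
  by rewrite -eq -e eb.
apply: eq_bigr => d dc; congr (alt_coef k _).
apply: (@eq_from_nth _ 0%N) => [|i]; rewrite !size_letters_at // => id.
have [q eq cq] := place d i (ltn_ord d) id.
rewrite !(nth_letters_at _ id eq) tnth_mktuple tpermD //.
  by apply: contra dc => /eqP e; apply/eqP/val_inj; rewrite /= -cq -e.
by apply: contra dc => /eqP e; apply/eqP/val_inj; rewrite /= -cq -e /c cab.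
Qed.

Lemma hw_tensor_neq0 : hw_tensor k r la != 0.
Proof.
have off_lt (q : 'I_r) : (q - sumn (take (place_column hs q) hs) < r)%N.
  by have := ltn_ord q; lia.
pose w : word r := [tuple Ordinal (off_lt q) | q < r].
apply/eqP => /ffunP /(_ w) /eqP; rewrite hw_tensorE ffunE big1 ?oner_eq0 // => c _.
rewrite -[RHS](alt_coef_iota k (nth 0%N hs c)); congr (alt_coef k _).
apply: (@eq_from_nth _ 0%N); rewrite size_letters_at ?size_iota // => i ic.
have qr : (sumn (take c hs) + i < r)%N by have := sumn_take_leq sum_hs (ltn_ord c); lia.
rewrite (nth_letters_at (q := Ordinal qr) _ ic) // tnth_mktuple nth_iota //=.
suff -> : place_column hs (Ordinal qr) = c by rewrite addKn.
apply/eqP; rewrite (place_columnE sum_hs) //=; lia.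
Qed.

Lemma hw_tensor_garnir : 2%:R != 0 :> k ->
  garnir (@place_column hs r) (@place_act k r) (hw_tensor k r la).
Proof.
move=> k2; apply: (garnir_of_bounded k2 (card_col_class sum_hs)) => //.
  exact: hw_tensor_alternating.
exact: hw_tensor_large.
Qed.

End HighestWeight.

(** * Equivariant maps and place permutations *)

Section SchurAlgebra.

Variables (k : fieldType) (r : nat).
Notation T := (tensorsp k r).
Notation n2 := #|{: 'I_r * 'I_r}|.

(** The monomial in the entries of a matrix $g$ that is the coefficient of $e_w$ in
    $ge_u$. *)
Definition pair_mon (w u : word r) : 'X_{1..n2} :=
  (\sum_(j < r) U_(enum_rank (tnth w j, tnth u j)))%MM.

(** The coefficient of the monomial $m$ in the action of the generic matrix. These
    operators span the Schur algebra, and stability under $GL_r$ is stability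
    under them. *)
Definition schur_op (m : 'X_{1..n2}) (x : T) : T :=
  [ffun w => \sum_(u | pair_mon w u == m) x u].

Lemma schur_op_is_linear m : linear (schur_op m).
Proof.
move=> a x y; apply/ffunP => w; rewrite !ffunE scaler_sumr -big_split /=.
by apply: eq_bigr => u _; rewrite !ffunE.
Qed.

HB.instance Definition _ m := GRing.isLinear.Build k T T _ (schur_op m)
  (schur_op_is_linear m).

Definition pair_mons : seq 'X_{1..n2} :=
  undup [seq pair_mon x.1 x.2 | x : word r * word r].

Lemma pair_mon_in w u : pair_mon w u \in pair_mons.
Proof.
rewrite mem_undup; apply/mapP; exists (w, u) => //; exact: mem_enum.
Qed.

Definition mon_value (A : comUnitRingType) (g : 'M[A]_r) (m : 'X_{1..n2}) : A :=
  \prod_(i < n2) g (enum_val i).1 (enum_val i).2 ^+ m i.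

Lemma mon_valueE (A : comUnitRingType) (g : 'M[A]_r) (w u : word r) :
  \prod_(j < r) g (tnth w j) (tnth u j) = mon_value g (pair_mon w u).
Proof.
rewrite /mon_value /pair_mon.
under [RHS]eq_bigr => i _ do rewrite mnm_sumE -prodrXr.
rewrite exchange_big /=; apply: eq_bigr => j _.
rewrite (bigD1 (enum_rank (tnth w j, tnth u j))) //= mnm1E eqxx enum_rankK /= expr1.
by rewrite big1 ?mulr1 // => i ne; rewrite mnm1E eq_sym (negbTE ne) expr0.
Qed.

Lemma gl_act_schur (A : comUnitRingType) (iota : {rmorphism k -> A}) (g : 'M[A]_r) x w :
  gl_act g (base_change iota x) w =
  \sum_(m <- pair_mons) mon_value g m * iota (schur_op m x w).
Proof.
rewrite ffunE; under [RHS]eq_bigr => m _ do rewrite ffunE rmorph_sum mulr_sumr big_mkcond.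
rewrite exchange_big /=; apply: eq_bigr => u _; rewrite ffunE mon_valueE.
rewrite (bigD1_seq (pair_mon w u)) ?pair_mon_in ?undup_uniq //= eqxx big1 ?addr0 // => m ne.
by rewrite eq_sym (negbTE ne).
Qed.

Definition schur_closed (W : {vspace T}) : Prop :=
  forall m v, v \in W -> schur_op m v \in W.

Lemma schur_closed_stable (W : {vspace T}) : schur_closed W -> gl_stable W.
Proof.
move=> cW A iota g _ v vW.
exists (size pair_mons), (fun i => mon_value g (nth 0%MM pair_mons i)),
  (fun i => schur_op (nth 0%MM pair_mons i) v); split=> [i|]; first exact: cW.
by apply/ffunP => w; rewrite gl_act_schur [RHS]ffunE (big_nth 0%MM) big_mkord.
Qed.

(** The generic matrix, with independent indeterminates as entries, is invertible
    over the field of rational functions, and there distinct monomials are linearly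
    independent over $k$. *)
Definition generic_ring := {fraction {mpoly k[n2]}}.

Definition generic_iota : {rmorphism k -> generic_ring} :=
  @tofrac {mpoly k[n2]} \o @mpolyC n2 k.

Definition generic_matrix : 'M[generic_ring]_r :=
  map_mx (@tofrac _) (\matrix_(a, b) ('X_(enum_rank (a, b)) : {mpoly k[n2]})).

Lemma generic_matrix_unit : generic_matrix \in unitmx.
Proof.
rewrite unitmxE unitfE det_map_mx tofrac_eq0.
pose v (i : 'I_n2) : k := ((enum_val i).1 == (enum_val i).2 :> 'I_r)%:R.
apply/eqP => /(congr1 (meval v)); rewrite rmorph0 -det_map_mx => /eqP.
have -> : map_mx (meval v) (\matrix_(a, b) ('X_(enum_rank (a, b)) : {mpoly k[n2]})) = 1%:M.
  by apply/matrixP => a b; rewrite !mxE mevalXU /v enum_rankK.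
by rewrite det1 oner_eq0.
Qed.

Lemma mon_value_generic m : mon_value generic_matrix m = tofrac 'X_[m].
Proof.
rewrite mpolyXE_id rmorph_prod; apply: eq_bigr => i _.
by rewrite rmorphXn !mxE -surjective_pairing enum_valK.
Qed.

Lemma generic_coef (s t : 'X_{1..n2} -> k) :
    \sum_(m <- pair_mons) mon_value generic_matrix m * generic_iota (s m) =
    \sum_(m <- pair_mons) mon_value generic_matrix m * generic_iota (t m) ->
  forall m, m \in pair_mons -> s m = t m.
Proof.
have E (f : 'X_{1..n2} -> k) :
    \sum_(m <- pair_mons) mon_value generic_matrix m * generic_iota (f m) =
    tofrac (\sum_(m <- pair_mons) f m *: 'X_[m]).
  rewrite rmorph_sum; apply: eq_bigr => m _.
  by rewrite mon_value_generic -[generic_iota _]/(tofrac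
    (f m)%:MP) -rmorphM mulrC mul_mpolyC.
rewrite !E => /eqP; rewrite tofrac_eq => /eqP e m mm.
have C (f : 'X_{1..n2} -> k) : (\sum_(m <- pair_mons) f m *: 'X_[m])@_m = f m.
  rewrite raddf_sum (bigD1_seq m) ?undup_uniq //= mcoeffZ mcoeffX eqxx mulr1.
  by rewrite big1 ?addr0 // => m' ne; rewrite mcoeffZ mcoeffX (negbTE ne) mulr0.
by rewrite -(C s) e C.
Qed.

(** Reading the identity in the definition of stability off at the generic
    matrix: the coefficients of the monomials are the operators above, and a
    linear map over $k$ may be applied on both sides. *)
Lemma generic_linear (P : 'End(T)) m (a : 'I_m -> generic_ring) (b : 'I_m -> T) (v : T) w :
    gl_act generic_matrix (base_change generic_iota v) = tens_comb generic_iota a b ->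
  \sum_(q <- pair_mons) mon_value generic_matrix q * generic_iota (P (schur_op q v) w) =
  \sum_i a i * generic_iota (P (b i) w).
Proof.
move=> e; have PE y : P y w = \sum_u y u * P [ffun u' => (u' == u)%:R] w.
  have {1}-> : y = \sum_u y u *: ([ffun u' => (u' == u)%:R] : T).
    apply/ffunP => q; rewrite sum_ffunE (bigD1 q) //= !ffunE eqxx.
    rewrite big1 => [|u uq]; last
      by rewrite !ffunE eq_sym (negbTE uq) /GRing.scale /= mulr0.
    by rewrite addr0 /GRing.scale /= mulr1.
  by rewrite linear_sum sum_ffunE; apply: eq_bigr => u _; rewrite linearZ ffunE.
have expand (B : comUnitRingType) (io : {rmorphism k -> B}) (I : Type) (s : seq I) (c
  : I -> B) (y : I -> T) :
    \sum_(i <- s) c i * io (P (y i) w) =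
    \sum_u (\sum_(i <- s) c i * io (y i u)) * io (P [ffun u' => (u' == u)%:R] w).
  under eq_bigr => i _ do rewrite PE rmorph_sum mulr_sumr.
  rewrite exchange_big /=; apply: eq_bigr => u _; rewrite mulr_suml.
  by apply: eq_bigr => i _; rewrite rmorphM mulrA.
rewrite [LHS]expand [RHS]expand; apply: eq_bigr => u _; congr (_ * _).
by rewrite -gl_act_schur e ffunE.
Qed.

Lemma stable_schur_closed (W : {vspace T}) : gl_stable W -> schur_closed W.
Proof.
move=> sW m v vW; have [N [a [b [bW e]]]] := sW _ generic_iota _ generic_matrix_unit v vW.
have [mm|nm] := boolP (m \in pair_mons); last first.
  suff -> : schur_op m v = 0 by apply: mem0v.
  apply/ffunP => w; rewrite !ffunE big1 // => u /eqP em.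
  by rewrite -em pair_mon_in in nm.
pose P : 'End(T) := (\1 - projv W)%VF.
have P0 x : x \in W -> P x = 0 by move=> xW;
  rewrite add_lfunE opp_lfunE id_lfunE projv_id // subrr.
suff P0' : P (schur_op m v) = 0.
  by move/eqP: P0'; rewrite add_lfunE opp_lfunE id_lfunE subr_eq0 => /eqP ->;
    apply: memv_proj.
apply/ffunP => w; rewrite [RHS]ffunE.
apply: (generic_coef (s := fun q => P (schur_op q v) w) (t := fun=> 0)) => //.
rewrite (generic_linear P w e) big1 => [|i _]; last by rewrite P0 // ffunE rmorph0 mulr0.
by rewrite big1 // => i _; rewrite rmorph0 mulr0.
Qed.

Lemma hom_schur (W : {vspace T}) (f : 'Hom(subvs_of W, T)) : gl_stable W -> gl_hom f ->
  forall m (v : subvs_of W), f (vsproj W (schur_op m (vsval v))) = schur_op m (f v).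
Proof.
move=> sW hf m v; have vW := subvsP v.
have [N [a [b [bW e]]]] := sW _ generic_iota _ generic_matrix_unit _ vW.
have [mm|nm] := boolP (m \in pair_mons); last first.
  have z x : schur_op m x = 0.
    apply/ffunP => w; rewrite !ffunE big1 // => u /eqP em.
    by rewrite -em pair_mon_in in nm.
  by rewrite !z !linear0.
have e' : gl_act generic_matrix (base_change generic_iota (vsval v)) =
    tens_comb generic_iota a (fun i => vsval (vsproj W (b i))).
  by rewrite e; apply/ffunP => w; rewrite !ffunE; apply: eq_bigr => i _; rewrite vsprojK.
have := hf _ _ _ generic_matrix_unit v _ _ _ e'.
move=> ef; apply/ffunP => w.
pose F : 'End(T) := (f \o linfun (vsproj W))%VF.
have FE x : F x = f (vsproj W x) by rewrite comp_lfunE lfunE.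
have := generic_linear F w e'; rewrite -FE.
under [in RHS]eq_bigr => i _ do rewrite FE vsvalK.
have -> : \sum_i a i * generic_iota (f (vsproj W (b i)) w) =
    gl_act generic_matrix (base_change generic_iota (f v)) w by rewrite ef ffunE.
rewrite gl_act_schur => /generic_coef; exact.
Qed.

Definition base_word : word r := [tuple j | j < r].

Lemma pair_mon_place s (w u : word r) :
  pair_mon (place_word s w) (place_word s u) = pair_mon w u.
Proof.
rewrite /pair_mon [RHS](reindex_inj (@perm_inj _ s)) /=.
by apply: eq_bigr => j _; rewrite !tnth_mktuple.
Qed.

Lemma pair_mon_mem (w u : word r) a b :
  reflect (exists2 j, tnth w j = a & tnth u j = b)
    (pair_mon w u (enum_rank (a, b)) != 0)%N.
Proof.
rewrite /pair_mon mnm_sumE sum_nat_eq0 negb_forall; apply: (iffP existsP).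
  case=> j; rewrite mnm1E (inj_eq enum_rank_inj) xpair_eqE eqb0 negbK =>
    /andP [/eqP <- /eqP <-].
  by exists j.
by case=> j <- <-; exists j; rewrite mnm1E eqxx.
Qed.

(** The pairs $(j,w_j)$ occurring in the monomial are the graph of $w$; any other pair
    of words with this monomial lists the same graph in another order. *)
Lemma pair_mon_base (v u w : word r) : pair_mon v u = pair_mon base_word w ->
  exists2 s, v = place_word s base_word & u = place_word s w.
Proof.
move=> e; have onto a : exists j, tnth v j = a.
  have : pair_mon v u (enum_rank (a, tnth w a)) != 0%N.
    by rewrite e; apply/pair_mon_mem; exists a; rewrite ?tnth_mktuple.
  by case/pair_mon_mem => j <- _; exists j.
have v_inj : injective (tnth v).
  apply/injectiveP; apply: (@leq_size_uniq _ (enum 'I_r)); rewrite ?enum_uniq //.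
    by move=> a _; have [j <-] := onto a; apply: codom_f.
  by rewrite size_codom -cardE.
have ev : v = place_word (perm v_inj) base_word.
  by apply: eq_from_tnth => j; rewrite !tnth_mktuple permE.
exists (perm v_inj) => //; apply: eq_from_tnth => j; rewrite tnth_mktuple permE.
have : pair_mon v u (enum_rank (tnth v j, tnth u j)) != 0%N by apply/pair_mon_mem; exists j.
by rewrite e => /pair_mon_mem [i <-]; rewrite tnth_mktuple => ->.
Qed.

(** The operator of the monomial of $(\omega,w)$, where $\omega=(0,\dots,r-1)$,
    carries $v$ to the sum over $s$ of the coordinate of $v$ at $w$ permuted by $s$
    times $e_{\omega s}$. Since $f$ commutes with it, the coordinate of $f(v)$ at
    $w$ is a fixed linear form in the coordinates of $v$ at the permuted words; its
    coefficients are those of the place permutations. In other words, tensor space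
    is an injective module over the Schur algebra. *)
Lemma hom_place_act (W : {vspace T}) (f : 'Hom(subvs_of W, T)) :
    gl_stable W -> gl_hom f ->
  exists c : 'S_r -> k, forall v : subvs_of W, f v = \sum_s c s *: place_act s (vsval v).
Proof.
move=> sW hf.
pose delta s : T := [ffun u => (u == place_word s base_word)%:R].
pose F : 'End(T) := (f \o linfun (vsproj W))%VF.
have FE x : F x = f (vsproj W x) by rewrite comp_lfunE lfunE.
exists (fun s => F (delta s) base_word) => v; apply/ffunP => w.
have opE (y : T) : schur_op (pair_mon base_word w) y = \sum_s y (place_word s w) *: delta s.
  apply/ffunP => q; rewrite ffunE sum_ffunE.
  have [/existsP [s /eqP ->]|no_s] := boolP [exists s, q == place_word s base_word].
    rewrite (big_pred1 (place_word s w)) => [|u]; last first.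
      apply/eqP/eqP => [/pair_mon_base [t est ->]|->]; last exact: pair_mon_place.
      congr (place_word _ w); apply/permP => j.
      by have := congr1 (fun q : word r => tnth q j) est; rewrite !tnth_mktuple => ->.
    rewrite (bigD1 s) //= !ffunE eqxx /GRing.scale /= mulr1 big1 ?addr0 // => t ts.
    rewrite !ffunE (_ : _ == _ = false) /GRing.scale /= ?mulr0 //.
    apply: contraNF ts => /eqP est; apply/eqP/permP => j.
    by have := congr1 (fun q : word r => tnth q j) est; rewrite !tnth_mktuple.
  rewrite big1 => [|u /eqP /pair_mon_base [s es _]]; last first.
    by case/existsP: no_s; exists s; apply/eqP.
  rewrite big1 // => s _; rewrite !ffunE (_ : _ == _ = false) /GRing.scale /= ?mulr0 //.
  by apply: contraNF no_s => h; apply/existsP; exists s.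
have -> : f v w = schur_op (pair_mon base_word w) (f v) base_word.
  rewrite ffunE (big_pred1 w) // => u; apply/eqP/eqP => [/pair_mon_base [s est ->]|-> //].
  suff -> : s = 1%g by apply: eq_from_tnth => j; rewrite tnth_mktuple perm1.
  apply/permP => j; rewrite perm1.
  by have := congr1 (fun q : word r => tnth q j) est; rewrite !tnth_mktuple => <-.
rewrite -hom_schur // -FE opE linear_sum !sum_ffunE; apply: eq_bigr => s _.
by rewrite linearZ !ffunE /GRing.scale /= mulrC.
Qed.

Lemma place_act_hom (W : {vspace T}) (f : 'Hom(subvs_of W, T)) (c : 'S_r -> k) :
  (forall v, f v = \sum_s c s *: place_act s (vsval v)) -> gl_hom f.
Proof.
move=> fE A iota g _ v m a b e; apply/ffunP => w; rewrite !ffunE.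
have place s : \sum_u (\prod_j g (tnth w j) (tnth u j)) * iota (vsval v (place_word s u)) =
    \sum_i a i * iota (vsval (b i) (place_word s w)).
  have := congr1 (fun x : tensorsp A r => x (place_word s w)) e; rewrite !ffunE => <-.
  rewrite [RHS](reindex_inj (@place_word_inj r s)) /=; apply: eq_bigr => u _;
    rewrite ffunE; congr (_ * _).
  rewrite [LHS](reindex_inj (@perm_inj _ s)) /=.
  by apply: eq_bigr => j _; rewrite !tnth_mktuple.
have fw x (q : word r) : f x q = \sum_s c s * vsval x (place_word s q).
  by rewrite fE sum_ffunE; apply: eq_bigr => s _; rewrite !ffunE.
under eq_bigr => u _ do rewrite ffunE fw rmorph_sum mulr_sumr.
under [RHS]eq_bigr => i _ do rewrite fw rmorph_sum mulr_sumr.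
rewrite exchange_big [RHS]exchange_big /=; apply: eq_bigr => s _.
under eq_bigr => u _ do rewrite rmorphM mulrCA.
by rewrite -mulr_sumr place mulr_sumr; apply: eq_bigr => i _; rewrite rmorphM mulrCA.
Qed.

(** Stable subspaces are closed under intersection, because they are the subspaces
    closed under the operators above. *)
Lemma weyl_exists (la : seq nat) : exists W : {vspace T}, is_weyl la W.
Proof.
suff min (d : nat) (U : {vspace T}) : (\dim U < d)%N -> hw_tensor k r la \in U ->
    schur_closed U -> exists W : {vspace T}, is_weyl la W.
  exact: (min _ fullv (ltnSn _) (memvf _) (fun _ _ _ => memvf _)).
elim: d U => // d IHd U; rewrite ltnS => dU hU cU.
have [min|nmin] := classic (forall U' : {vspace T},
  hw_tensor k r la \in U' -> gl_stable U' -> (U <= U')%VS).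
  by exists U; split=> //; apply: schur_closed_stable.
have [U' [hU' sU' nUU']] : exists U' : {vspace T},
    [/\ hw_tensor k r la \in U', gl_stable U' & ~~ (U <= U')%VS].
  apply: NNPP => no; apply: nmin => U' hU' sU'; apply: contraT => nUU'.
  by case: no; exists U'.
apply: (IHd (U :&: U')%VS).
- apply: leq_trans dU; rewrite ltnNge; apply: contra nUU' => le.
  by rewrite (eqP (_ : U == (U :&: U')%VS)) ?capvSr // eq_sym eqEdim capvSl.
- by rewrite memv_cap hU.
move=> m v; rewrite !memv_cap => /andP [vU vU'].
by rewrite cU //= (stable_schur_closed sU').
Qed.

End SchurAlgebra.

(** * Simple quotients of the Specht module *)

Section SpechtQuotients.

Variables (k : fieldType) (r : nat) (la : seq nat).
Notation T := (tensorsp k r).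
Notation hw := (hw_tensor k r la).

Lemma schur_op_place m s (x : T) : schur_op m (place_act s x) = place_act s (schur_op m x).
Proof.
apply/ffunP => w; rewrite !ffunE.
rewrite [RHS](reindex_inj (@place_word_inj r s)) /=; apply: eq_big => [u|u _];
  last by rewrite ffunE.
by rewrite pair_mon_place.
Qed.

(** The part of $W$ killed by $L$ is stable and contains the generator of $W$. *)
Lemma weyl_annihilated (W : {vspace T}) (L : 'End(T)) : is_weyl la W ->
    (forall m x, schur_op m (L x) = L (schur_op m x)) -> L hw = 0 ->
  forall x, x \in W -> L x = 0.
Proof.
case=> hW sW minW comm L0 x xW.
have : (W <= W :&: lker L)%VS.
  apply: minW; first by rewrite memv_cap hW memv_ker L0 eqxx.
  apply: schur_closed_stable => m v; rewrite !memv_cap !memv_ker => /andP [vW /eqP Lv].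
  by rewrite (stable_schur_closed sW) //= -comm Lv linear0.
by move/subvP => /(_ x xW); rewrite memv_cap memv_ker => /andP [_ /eqP].
Qed.

Definition inclusion (W : {vspace T}) : 'Hom(subvs_of W, T) := linfun vsval.

Lemma inclusionE (W : {vspace T}) v : inclusion W v = vsval v.
Proof. by rewrite lfunE. Qed.

Lemma place_compE (W : {vspace T}) s v :
  (linfun (place_act s) \o inclusion W)%VF v = place_act s (vsval v).
Proof. by rewrite comp_lfunE lfunE /= inclusionE. Qed.

(** The image of the inclusion of the Weyl module generates the quotient and
    inherits the relations of the highest weight tensor. *)
Lemma quotient_garnir (col : 'I_r -> nat) d (rD : mx_representation k [set: 'S_r] d) :
    garnir col (@place_act k r) hw -> simple_quotient_specht la rD ->
  exists2 u : 'rV[k]_d, u != 0 & garnir col (fun s w => w *m rD s) u.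
Proof.
case=> alt ex [[_ nz _] [W [hW [pi [piE pi_onto]]]]]; have [_ sW _] := hW.
have incl_hom : gl_hom (inclusion W).
  apply: (@place_act_hom _ _ _ _ (fun s => (s == 1%g)%:R)) => v.
  rewrite (bigD1 1%g) //= eqxx scale1r big1 ?addr0.
    by rewrite (right_act1 (place_right_action k r)) inclusionE.
  by move=> s /negbTE ->; rewrite scale0r.
exists (pi (inclusion W)); last split.
- apply: contraNneq nz => u0; apply/eqP/row_matrixP => i; rewrite rowE mulmx1 row0.
  have [f hf <-] := pi_onto (delta_mx 0 i).
  have [c fE] := hom_place_act sW hf.
  have -> : f = \sum_s c s *: (linfun (place_act s) \o inclusion W)%VF.
    apply/lfunP => v; rewrite fE sum_lfunE; apply: eq_bigr => s _.
    by rewrite scale_lfunE place_compE.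
  rewrite linear_sum big1 // => s _.
  by rewrite linearZ /= piE // u0 mul0mx scaler0.
- move=> a b ab cab; rewrite -piE // -linearN; congr (pi _); apply/lfunP => v.
  rewrite place_compE opp_lfunE inclusionE; apply/eqP; rewrite -addr_eq0; apply/eqP.
  pose L : 'End(T) := (linfun (place_act (tperm a b)) + \1)%VF.
  have LE x : L x = place_act (tperm a b) x + x by rewrite add_lfunE id_lfunE lfunE.
  rewrite -LE; apply: (weyl_annihilated hW) (subvsP v).
    by move=> m x; rewrite !LE linearD /= schur_op_place.
  by rewrite LE alt // addNr.
move=> x c cx; under eq_bigr => a _ do rewrite -piE //.
rewrite -linear_sum; congr (pi _); apply/lfunP => v.
rewrite sum_lfunE inclusionE; under eq_bigr => a _ do rewrite place_compE.
apply/eqP; rewrite -subr_eq0; apply/eqP.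
pose L : 'End(T) := (\1 - \sum_(a in col_class col c) linfun (place_act (tperm a x)))%VF.
have LE y : L y = y - \sum_(a in col_class col c) place_act (tperm a x) y.
  rewrite add_lfunE opp_lfunE id_lfunE sum_lfunE; congr (_ - _).
  by apply: eq_bigr => a _; rewrite lfunE.
rewrite -LE; apply: (weyl_annihilated hW) (subvsP v).
  move=> m y; rewrite !LE linearB linear_sum /=; congr (_ - _).
  by apply: eq_bigr => a _; rewrite schur_op_place.
by rewrite LE -ex // subrr.
Qed.

Notation coefs := {ffun 'S_r -> k^o}.

Definition hom_comb (W : {vspace T}) (c : coefs) : 'Hom(subvs_of W, T) :=
  \sum_s c s *: (linfun (place_act s) \o inclusion W)%VF.

Lemma hom_comb_is_linear W : linear (hom_comb W).
Proof.
move=> a x y; rewrite /hom_comb scaler_sumr -big_split /=; apply: eq_bigr => s _.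
by rewrite !ffunE scalerDl scalerA.
Qed.

HB.instance Definition _ W := GRing.isLinear.Build k coefs _ _ (hom_comb W)
  (hom_comb_is_linear W).

Lemma hom_combE W c v : hom_comb W c v = \sum_s c s *: place_act s (vsval v).
Proof.
rewrite /hom_comb sum_lfunE; apply: eq_bigr => s _.
by rewrite scale_lfunE place_compE.
Qed.

Definition orbit_comb d (rD : mx_representation k [set: 'S_r] d) (u : 'rV[k]_d)
    (c : coefs) : 'rV[k]_d :=
  \sum_s c s *: (u *m rD s).

Lemma orbit_comb_is_linear d rD u : linear (@orbit_comb d rD u).
Proof.
move=> a x y; rewrite /orbit_comb scaler_sumr -big_split /=; apply: eq_bigr => s _.
by rewrite !ffunE scalerDl scalerA.
Qed.

HB.instance Definition _ d rD u := GRing.isLinear.Build k coefs _ _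
  (@orbit_comb d rD u) (@orbit_comb_is_linear d rD u).

(** The Specht module consists of the combinations of place permutations restricted to
    the Weyl module. Sending such a combination to its value at $u$ is
    well defined by the comparison of annihilators. *)
Lemma quotient_of_garnir (p : nat) (col : 'I_r -> nat) d
    (rD : mx_representation k [set: 'S_r] d) (u : 'rV[k]_d) :
    p \in [pchar k] -> (forall c, (#|col_class col c| < p)%N) ->
    garnir col (@place_act k r) hw -> hw != 0 ->
    mx_irreducible rD -> u != 0 -> garnir col (fun s w => w *m rD s) u ->
  simple_quotient_specht la rD.
Proof.
move=> hp small ghw hw0 irr u0 gu; split=> //; have [_ _ simple] := irr.
have [W hW] := weyl_exists k r la; exists W; split=> //; have [hwW sW _] := hW.
pose L : 'Hom(coefs, 'Hom(subvs_of W, T)) := linfun (hom_comb W).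
pose R : 'Hom(coefs, 'rV[k]_d) := linfun (orbit_comb rD u).
have LE c : L c = hom_comb W c by rewrite lfunE.
have RE c : R c = orbit_comb rD u c by rewrite lfunE.
have ann c : L c = 0 -> R c = 0.
  move=> Lc; rewrite RE; apply: (garnir_ann hp small irr gu
    (place_right_action k r) ghw hw0).
  have := congr1 (fun f : 'Hom(subvs_of W, T) => f (vsproj W hw)) Lc.
  by rewrite LE hom_combE zero_lfunE vsprojK.
(* As ker L is contained in ker R, the map R factors through the image of L. *)
have RLV c : R (L^-1%VF (L c)) = R c.
  apply/eqP; rewrite -subr_eq0 -linearB; apply/eqP/ann.
  by rewrite linearB /= limg_lfunVK ?subrr // memv_img ?memvf.
have span f : gl_hom f -> exists c, f = L c.
  move=> hf; have [c fE] := hom_place_act sW hf; exists [ffun s => c s].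
  apply/lfunP => v; rewrite LE hom_combE fE.
  by apply: eq_bigr => s _; rewrite ffunE.
exists (R \o L^-1)%VF; split=> [t f hf|v].
  have [c ->] := span f hf; rewrite !comp_lfunE RLV.
  have -> : (linfun (place_act t) \o L c)%VF = L [ffun s => c (s * t^-1)%g].
    apply/lfunP => v; rewrite comp_lfunE lfunE /= !LE !hom_combE linear_sum.
    rewrite [RHS](reindex_inj (mulIg t)) /=; apply: eq_bigr => s _.
    by rewrite ffunE mulgK linearZ /= (right_actM (place_right_action k r)).
  rewrite RLV !RE /orbit_comb mulmx_suml (reindex_inj (mulIg t)) /=; apply: eq_bigr => s _.
  by rewrite ffunE mulgK -scalemxAl repr_mxM ?inE // mulmxA.
have : (v <= cyclic_mx rD u)%MS.
  apply: submx_trans (submx1 v) _.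
  by apply: simple; rewrite ?cyclic_mx_module ?submx1 ?cyclic_mx_eq0.
case/cyclic_mxP => A /envelop_mxP [b ->] ->.
exists (L [ffun s => b s]).
  by rewrite LE; apply: (@place_act_hom _ _ _ _ [ffun s => b s]) => x; apply: hom_combE.
rewrite comp_lfunE RLV RE /orbit_comb mulmx_sumr; apply: eq_big => [s|s _];
  first by rewrite inE.
by rewrite ffunE scalemxAr.
Qed.

End SpechtQuotients.

(** * Dimensions and the recursion *)

Section Dimension.

Variables (k : fieldType) (p : nat).
Hypotheses (hp : p \in [pchar k]) (hp2 : (2 < p)%N).

Lemma Lambda_barP r n (la : 'rV[int]_n.+1) : Lambda_bar p r la ->
  [/\ forall i, 0 <= la 0 i, bottom_alcove p la, \sum_i la 0 i = r%:Z & (n.+1 < p)%N].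
Proof.
case/and3P => /and3P [_ /forallP ge0 /eqP sum] alc np; split=> //.
Qed.

Theorem dimD_walks r n (la : 'rV[int]_n.+1) :
  Lambda_bar p r la -> dimD k r la = #|walks p r la|.
Proof.
case/Lambda_barP => ge0 alc sum np.
have [rG rGE] := seminormal_repr_exists hp np r la.
have irr := seminormal_irreducible hp np ge0 alc sum rGE.
have y0 := walk_vec_neq0 k (column_word_walk_to np ge0 alc sum).
have gy := column_word_garnir hp np ge0 alc sum rGE.
have sh := sum_heights np ge0 alc sum.
have small c : (#|col_class (@place_column (conj_part (parts la)) r) c| < p)%N.
  by rewrite (card_col_class sh) (leq_ltn_trans (height_le la c)).
have k2 : 2%:R != 0 :> k by apply: (natr_neq0_small hp); rewrite hp2.
have ghw := hw_tensor_garnir sh (height_antitone ge0 alc) k2.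
have hw0 := hw_tensor_neq0 k sh.
have ex : exists D : {d : nat & mx_representation k [set: 'S_r] d},
    simple_quotient_specht (parts la) (projT2 D).
  by exists (existT _ _ rG); apply: (quotient_of_garnir hp small ghw hw0 irr y0 gy).
have := epsilon_spec (inhabits (existT _ _ (regular_repr k [set: 'S_r]))) _ ex.
rewrite -/(simple_mod k r (parts la)) /dimD; case: (simple_mod _ _ _) => d rD /= hD.
have [u u0 gu] := quotient_garnir ghw hD.
exact: (garnir_irr_dim hp small hD.1 irr u0 y0 gu gy).
Qed.

Lemma walk_to_rcons r n (la : 'rV[int]_n.+1) w i : bottom_alcove p la ->
  walk_to p r.+1 la (rcons w i) = walk_to p r (la - delta_mx 0 i) w.
Proof.
move=> alc; rewrite /walk_to size_rcons eqSS alcove_walk_rcons add0r wt_rcons.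
rewrite [_ + _ == la]eq_sym -subr_eq [_ == wt w]eq_sym.
by case: (eqVneq (wt w) _) => [->|_]; rewrite ?andbF // subrK alc andbT.
Qed.

Lemma card_walks_last r n (la : 'rV[int]_n.+1) : bottom_alcove p la ->
  #|walks p r.+1 la| = (\sum_(i < n.+1) #|walks p r (la - delta_mx 0 i)%R|)%N.
Proof.
move=> alc; rewrite -sum1_card (partition_big (fun w => tnth w ord_max) predT) //=.
apply: eq_bigr => i _; rewrite sum1dep_card.
have inj : injective (fun w : r.-tuple 'I_n.+1 => [tuple of rcons w i]).
  by move=> v w /(congr1 val) /= /rcons_inj [/val_inj].
rewrite -(card_imset _ inj); apply: eq_card => w; rewrite !inE.
apply/idP/imsetP => [/andP [hw /eqP ei]|[v + ->]].
  case: w hw ei => s ss; case/lastP: s ss => // s j ss hw.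
  rewrite (tnth_nth ord0) /= nth_rcons.
  have sz : size s = r by have := eqP ss; rewrite size_rcons => -[].
  rewrite sz ltnn eqxx => ej; have szb : size s == r by rewrite sz.
  exists (Tuple szb); last by apply: val_inj; rewrite /= ej.
  by rewrite inE -walk_to_rcons // -ej.
rewrite inE -walk_to_rcons // => ->.
by rewrite (tnth_nth ord0) /= nth_rcons size_tuple ltnn !eqxx.
Qed.

Lemma walk_to_Lambda_bar r n (la : 'rV[int]_n.+1) w :
  (n.+1 < p)%N -> walk_to p r la w -> Lambda_bar p r la.
Proof.
move=> np /and3P [/eqP sw ww /eqP ew]; have := alcove_walk_end ww.
rewrite add0r ew => alc; rewrite /Lambda_bar np alc !andbT /partition_of.
have /andP [dom _] := alc; apply/and3P; split=> //.
  by apply/forallP => i; rewrite -ew wt_ge0.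
by rewrite -ew sum_wt sw.
Qed.

End Dimension.

Theorem theorem4p7 (k : fieldType) (p : nat) (hp : p \in [pchar k])
    (hp2 : (2 < p)%N) (r : nat) (hr : (0 < r)%N) (n : nat)
    (la : 'rV[int]_n.+1) (hla : Lambda_bar p r la) :
  dimD k r la =
    (\sum_(i < n.+1 | Lambda_bar p r.-1 (la - delta_mx 0 i)%R)
       dimD k r.-1 (la - delta_mx 0 i)%R)%N.
Proof.
case: r hr hla => // r _ hla /=; have [_ alc _ np] := Lambda_barP hla.
rewrite (dimD_walks hp) // card_walks_last // [RHS]big_mkcond /=.
apply: eq_bigr => i _; case: ifP => [hi|/negbT hi]; first by rewrite (dimD_walks hp).
apply/eqP; rewrite cards_eq0; apply/eqP/setP => w; rewrite !inE.
by apply/negbTE; apply: contra hi => hw; apply: (walk_to_Lambda_bar np hw).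
Qed.
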